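(* Let $X=\{X_n\}$ be a stationary ergodic $A$-valued process with first-order marginal $P$, and let $Y=\{Y_n\}$ be i.i.d. with marginal distribution $Q$ on $\hat A$. Assume that $D_{\rm av}=E_{P\times Q}[\rho(X,Y)]$ is finite. Then for any $D\in(D_{\rm min},D_{\rm av})$, $$-\frac1n\log Q^n(B(X_1^n,D))\to R_1(P,Q,D)\quad\text{with probability one,}$$ where $$R_1(P,Q,D)=\inf_W H(W\|P\times Q),$$ and the infimum is over all joint probability distributions $W$ on $A\times\hat A$ such that the first marginal of $W$ is $P$ and $E_W[\rho(X,Y)]\le D$.
   Context: $A$ and $\hat A$ are complete separable metric spaces with their Borel $\sigma$-fields. $X=\{X_n: n\in\mathbb Z\}$ takes values in $A$, $P$ is the distribution of $X_1$, and $X_1^n=(X_1,\dots,X_n)$. $Q^n$ is the $n$-fold product measure on $\hat A^n$. $\rho:A\times\hat A\to[0,\infty)$ is an arbitrary measurable function, $\rho_n(x_1^n,y_1^n)=\frac1n\sum_{i=1}^n\rho(x_i,y_i)$, and $B(x_1^n,D)=\{y_1^n\in\hat A^n:\rho_n(x_1^n,y_1^n)\le D\}$. $D_{\rm min}=E_P[\operatorname{ess\,inf}_{Y\sim Q}\rho(X,Y)]$, where the essential infimum is with respect to $Y\sim Q$ for fixed $X$, and $\operatorname{ess\,inf}_{Y\sim Q} g(Y)=\sup\{t\in\mathbb R: Q\{g(Y)>t\}=1\}$. $D_{\rm av}=E_{P\times Q}[\rho(X,Y)]$. It is assumed that $D_{\rm min}<D_{\rm av}$. $\log$ is the natural logarithm.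 $H(W\|V)=E_W[\log\frac{dW}{dV}]$ if the density $dW/dV$ exists, and $H(W\|V)=\infty$ otherwise. *)

(* Defs.v *)
(* MathComp-Analysis. *)
From HB Require Import structures.
From mathcomp Require Import all_boot all_order all_algebra.
From mathcomp Require Import all_classical all_reals all_analysis.
From mathcomp Require Import ess_sup_inf.

Set Implicit Arguments.
Unset Strict Implicit.
Unset Printing Implicit Defensive.

Import Order.TTheory GRing.Theory Num.Theory.
Import numFieldNormedType.Exports.

Local Open Scope classical_set_scope.
Local Open Scope ring_scope.
Local Open Scope ereal_scope.

(* The base point is only there because measurable types are pointed; it
   amounts to the space being nonempty. *)
#[short(type="completeMetricType")]
HB.structure Definition CompleteMetric (R : numDomainType) :=
  {T of Complete T & PseudoPointedMetric R T & Metric R T}.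

HB.instance Definition _ (R : realType) := Complete.on R^o.

Definition separable (T : topologicalType) :=
  exists2 S : set T, countable S & dense S.

Notation borelType T := (g_sigma_algebraType (@open T)).

Section process.
Context d d' (Omega : measurableType d) (T : measurableType d') (R : realType).
Variables (Pr : probability Omega R) (X : int -> {RV Pr >-> T}).

(* The product sigma-field on the two-sided path space [int -> T]. *)
Definition path_events : set (set (int -> T)) :=
  <<s \bigcup_i preimage_set_system setT (fun x : int -> T => x i) measurable >>.

Definition shift (x : int -> T) : int -> T := fun i => x (i + 1)%R.

Definition path (w : Omega) : int -> T := fun i => X i w.

Definition stationary : Prop := forall C, path_events C ->
  Pr (path @^-1` (shift @^-1` C)) = Pr (path @^-1` C).

Definition ergodic : Prop := forall C, path_events C ->
  shift @^-1` C = C -> Pr (path @^-1` C) = 0 \/ Pr (path @^-1` C) = 1.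

End process.

Section power_measure.
Context d (T : measurableType d) (R : realType).

Definition cons_pair n (p : T * n.-tuple T) : n.+1.-tuple T :=
  [tuple of p.1 :: p.2].

Lemma measurable_cons_pair n : measurable_fun [set: T * n.-tuple T] (@cons_pair n).
Proof. exact: (@measurable_cons _ _ _ _ fst n snd). Qed.

HB.instance Definition _ n :=
  isMeasurableFun.Build _ _ _ _ (@cons_pair n) (@measurable_cons_pair n).

(* The n-fold product of Q, transported along T * T^n = T^(n+1). *)
Fixpoint power_measure (Q : probability T R) (n : nat) :
    probability (n.-tuple T) R :=
  match n with
  | 0 => \d_([tuple] : 0.-tuple T)
  | m.+1 => distribution (Q \x power_measure Q m) (@cons_pair m)
  end.

Lemma power_measureE (Q : probability T R) n (E : 'I_n -> set T) :
  (forall i, measurable (E i)) ->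
  power_measure Q n [set y | forall i, E i (tnth y i)] = \prod_(i < n) Q (E i).
Proof.
elim: n E => [|n IH] E mE.
  by rewrite big_ord0 /= diracE mem_set// => -[].
rewrite big_ord_recl -IH//= /distribution/= /pushforward/=.
have mF : measurable
    [set y : n.-tuple T | forall i, E (lift ord0 i) (tnth y i)].
  rewrite [X in measurable X](_ : _ = \bigcap_(i in [set: 'I_n])
    ((@tnth _ T ^~ i) @^-1` E (lift ord0 i))); last first.
    by apply/seteqP; split=> [y yE i _|y yE i]; [exact: yE|exact: (yE i I)].
  apply: fin_bigcap_measurable => // i _.
  by rewrite -[X in measurable X]setTI; exact: measurable_tnth.
rewrite -product_measure1E//; congr (_ _).
apply/seteqP; split=> [[x t] /= xtE|[x t] /= [xE tE] i].
  split=> [|i]; first by have := xtE ord0; rewrite (tnth_nth x).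
  by have := xtE (lift ord0 i); rewrite tnthS.
by case: (unliftP ord0 i) => [j|] ->; rewrite ?tnthS// (tnth_nth x).
Qed.

End power_measure.

Section distortion.
Context d d' (A : measurableType d) (B : measurableType d') (R : realType).
Variable rho : A * B -> R.

Definition distortion n (x : n.-tuple A) (y : n.-tuple B) : R :=
  (n%:R^-1 * \sum_(i < n) rho (tnth x i, tnth y i))%R.

Definition distortion_ball n (x : n.-tuple A) (D : R) : set (n.-tuple B) :=
  [set y | (distortion x y <= D)%R].

Variables (P : probability A R) (Q : probability B R).

Definition Dmin : \bar R :=
  \int[P]_x ess_inf Q (fun y => (rho (x, y))%:E).

Definition Dav : \bar R := \int[P \x Q]_z (rho z)%:E.

End distortion.

Lemma ess_infE d (T : measurableType d) (R : realType) (Q : probability T R)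
    (g : T -> R) : measurable_fun setT g ->
  ess_inf Q (EFin \o g) =
  ereal_sup [set t%:E | t in [set t | Q [set y | (t < g y)%R] = 1]].
Proof.
move=> mg.
have mgt t : measurable [set y | (t < g y)%R].
  rewrite -[X in measurable X]setTI.
  rewrite (_ : [set y | (t < g y)%R] = g @^-1` `]t, +oo[); first exact: mg.
  by apply/seteqP; split=> y /=; rewrite in_itv/= andbT.
have null_compl E : measurable E -> Q E = 1 -> Q (~` E) = 0.
  by move=> mE QE; rewrite probability_setC// QE subee.
apply/eqP; rewrite eq_le; apply/andP; split; last first.
  apply: ge_ereal_sup => _ [t /= Qt <-]; apply/ess_infP.
  exists (~` [set y | (t < g y)%R]); split.
  - exact: measurableC.
  - exact: null_compl.
  - by move=> y /= + tgy; apply; rewrite lee_fin ltW.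
apply/lee_subgt0Pr => e e0.
case: (ess_inf Q (EFin \o g)) (ess_inf_le Q (EFin \o g)) => [r| |] aeg.
- apply: ereal_sup_ubound; exists (r - e)%R => //=.
  case: aeg => N [mN QN sN].
  apply/eqP; rewrite eq_le probability_le1//=.
  have <- : Q (~` N) = 1 by rewrite probability_setC// QN sube0.
  apply: le_measure; rewrite ?inE//; first exact: measurableC.
  move=> y; rewrite -[X in _ -> X]notK => nNy /= gy.
  apply: nNy; apply: sN => /=; rewrite lee_fin => rg; apply: gy.
  by rewrite (lt_le_trans _ rg)// ltrBlDr ltrDl.
- case: aeg => N [mN QN sN].
  have : Q setT <= Q N.
    by apply: le_measure; rewrite ?inE// => y _; apply: sN; rewrite /= leye_eq.
  by rewrite QN probability_setT lee_fin ler10.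
- by rewrite /= leNye.
Qed.

(* By the Radon-Nikodym theorem the density exists iff W `<< V.  Since [lne] is
   extended-real valued with [lne 0 = -oo], no convention on [log 0] enters; the
   density vanishes only on a W-null set. *)
Definition relative_entropy d (T : measurableType d) (R : realType)
    (W V : probability T R) : \bar R :=
  if `[< W `<< V >] then
    \int[W]_z lne (Radon_Nikodym (charge_of_finite_measure W) V z)
  else +oo.

Definition rate1 d d' (A : measurableType d) (B : measurableType d')
    (R : realType) (rho : A * B -> R) (P : probability A R)
    (Q : probability B R) (D : R) : \bar R :=
  ereal_inf [set relative_entropy W (P \x Q) | W in
    [set W : probability (A * B)%type R |
       (forall E, measurable E -> W (E `*` setT) = P E) /\
       \int[W]_z (rho z)%:E <= D%:E]].

(* The block (X_1, ..., X_n). *)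
Definition block (A Omega : Type) (X : int -> Omega -> A) n (w : Omega) :
    n.-tuple A :=
  [tuple X (i.+1)%:Z w | i < n].

(* Main.v *)
Require Import Defs.
From HB Require Import structures.
From mathcomp Require Import all_boot all_order all_algebra.
From mathcomp Require Import all_classical all_reals all_analysis.
From mathcomp Require Import measurable_realfun ess_sup_inf lra ring.

(** The probability of a distortion ball is a small-deviation probability for
    a sum of independent, non-identically distributed terms: given the source
    word x, Q^n(B(x,D)) is the chance that the sum of the independent variables
    rho(x_i,Y_i) is at most nD.  It is governed by the Laplace transforms
    E_Q exp(-b rho(x,Y)), b >= 0.  Write U(x,b) for minus the logarithm
    of this transform (free_energy), G(b) = E_P U(X,b) (mean_free_energy), and
    M(b) for the mean of rho under the joint law Gibbs(b), whose first marginal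
    is P and whose conditional law given x is Q tilted by exp(-b rho(x,y))
    (mean_distortion).

    The function G is concave with derivative M; all that is used of this is
    the tangent inequality G(c) <= G(b) + (c - b) M(b) and the continuity of M.
    As b runs from 0 to infinity, M(b) runs continuously from Dav down to Dmin,
    because M(b) <= G(b)/b and U(x,b)/b tends to the essential infimum of
    rho(x,Y).  Hence M(bs) = D for some bs > 0, and the common value of the
    limit and of the rate is G(bs) - bs D.

    - The rate (rate1_gibbs).  If g = U(x,bs) - bs rho(x,y), then exp g is a
      probability density relative to P x Q.  The inequality
      E_W g <= H(W || P x Q) bounds the infimum from below, and equality holds
      for W with density exp g, which is Gibbs(bs) and satisfies the two
      constraints.

    - The lower bound for -log Q^n(B)/n is the Chernoff bound at bs
      (chernoff_upper): the exponents that appear are the ergodic averages of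
      U(X_i,bs), which converge to G(bs).

    - For the upper bound, one tilts by a temperature b2 whose mean distortion
      is slightly below D.  The tilted law puts almost all its mass on sums
      between nD0 and nD: both tails are again bounded by Chernoff, at
      temperatures b1 > b2 > b3 (tilting_lower), and the tangent inequality
      makes their exponents positive (exists_temperatures, eventually_ln_ge).

    The ergodic theorem is proved by the following argument.  Let h have a
    negative integral.  The set where the partial sums of h are unbounded above
    is invariant; were it of full measure, the maximal partial sums M_n would
    satisfy M_{n+1} - M_n o T -> h under an integrable bound, while these
    differences have nonnegative integrals (birkhoff_max_bounded). *)

Set Implicit Arguments.
Unset Strict Implicit.
Unset Printing Implicit Defensive.

Import Order.TTheory GRing.Theory Num.Theory.
Import numFieldNormedType.Exports.

Local Open Scope classical_set_scope.
Local Open Scope ring_scope.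
Local Open Scope ereal_scope.

(** * Birkhoff's ergodic theorem *)
Section Birkhoff.
Context d (S : measurableType d) (R : realType) (mu : probability S R).
Variable T : S -> S.
Hypothesis mT : measurable_fun setT T.
Hypothesis T_preserves : forall C, measurable C -> mu (T @^-1` C) = mu C.
Hypothesis T_ergodic : forall C, measurable C -> T @^-1` C = C ->
  mu C = 0 \/ mu C = 1.

Definition birkhoff_sum (h : S -> R) n x : R := (\sum_(i < n) h (iter i T x))%R.

Lemma birkhoff_sumS h n x :
  birkhoff_sum h n.+1 x = (h x + birkhoff_sum h n (T x))%R.
Proof.
rewrite /birkhoff_sum big_ord_recl; congr (_ + _)%R.
by apply: eq_bigr => i _; rewrite [lift _ _]/= iterSr.
Qed.

(** The maximum of the first n+1 nonempty partial sums; the recursion is the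
    identity on which the proof of the ergodic theorem rests. *)
Fixpoint birkhoff_max (h : S -> R) n x : R :=
  (if n is m.+1 then h x + Num.max 0 (birkhoff_max h m (T x)) else h x)%R.

Lemma birkhoff_sum_le_max h n x : (birkhoff_sum h n.+1 x <= birkhoff_max h n x)%R.
Proof.
elim: n x => [|n IH] x; first by rewrite birkhoff_sumS /birkhoff_sum big_ord0 addr0.
by rewrite birkhoff_sumS lerD2l (le_trans (IH _))// le_max lexx orbT.
Qed.

Lemma birkhoff_max_nd h n m x : (n <= m)%N ->
  (birkhoff_max h n x <= birkhoff_max h m x)%R.
Proof.
elim: n m x => [|n IH] [|m] x//= nm; first by rewrite lerDl le_max lexx.
by rewrite lerD2l ge_max !le_max lexx IH ?orbT.
Qed.

Lemma measurable_birkhoff_max h n : measurable_fun setT h ->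
  measurable_fun setT (birkhoff_max h n).
Proof.
move=> mh; elim: n => [//|n IH]; apply: measurable_funD => //.
by apply: measurable_maxr => //; exact: measurableT_comp IH mT.
Qed.

Lemma integrable_preserved (f : S -> R) : mu.-integrable setT (EFin \o f) ->
  mu.-integrable setT (EFin \o (f \o T)) /\
  \int[mu]_x (f (T x))%:E = \int[mu]_x (f x)%:E.
Proof.
move=> /integrableP[/measurable_EFinP mf fi].
have E (g : S -> \bar R) : measurable_fun setT g -> (forall x, 0 <= g x) ->
    \int[mu]_x g (T x) = \int[mu]_x g x.
  move=> mg g0.
  have := @ge0_integral_pushforward _ _ _ _ _ _ mT mu setT g measurableT mg _.
  rewrite preimage_setT => <- //.
  apply: eq_measure_integral => A mA _; exact: T_preserves.
split.
  apply/integrableP; split; first exact/measurable_EFinP/measurableT_comp.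
  rewrite (E (fun x => `|(f x)%:E|))//; exact/measurableT_comp/measurable_EFinP.
rewrite integralE [RHS]integralE; congr (_ - _).
  rewrite -(E (EFin \o f)^\+)//; first by apply: eq_integral => x _; rewrite !funeposE.
  by apply: measurable_funepos; exact/measurable_EFinP.
rewrite -(E (EFin \o f)^\-)//; first by apply: eq_integral => x _; rewrite !funenegE.
by apply: measurable_funeneg; exact/measurable_EFinP.
Qed.

Lemma integrable_birkhoff_max h n : mu.-integrable setT (EFin \o h) ->
  mu.-integrable setT (EFin \o birkhoff_max h n).
Proof.
move=> ih; have mh := measurable_int _ ih; move/measurable_EFinP : mh => mh.
elim: n => [//|n IH].
have := integrableD measurableT (integrable_abse ih) (integrable_abse (integrable_preserved IH).1).
apply: le_integrable => //; first exact/measurable_EFinP/(measurable_birkhoff_max n.+1).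
move=> x _ /=; rewrite lee_fin [leRHS]ger0_norm ?addr_ge0//.
rewrite (le_trans (ler_normD _ _))// lerD2l.
by case: (lerP 0 (birkhoff_max h n (T x))) => //; rewrite normr0.
Qed.


Definition birkhoff_unbounded h : set S :=
  [set x | forall k : nat, exists n, (k%:R <= birkhoff_max h n x)%R].

Lemma measurable_birkhoff_unbounded h : measurable_fun setT h ->
  measurable (birkhoff_unbounded h).
Proof.
move=> mh.
rewrite (_ : birkhoff_unbounded h = \bigcap_(k in setT) \bigcup_(n in setT)
    (birkhoff_max h n @^-1` `[k%:R, +oo[)).
  apply: bigcapT_measurable => k; apply: bigcupT_measurable => n.
  rewrite -[X in measurable X]setTI; exact: measurable_birkhoff_max.
apply/seteqP; split=> x.
  by move=> xh k _; have [n kn] := xh k; exists n => //=; rewrite in_itv/= kn.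
by move=> xh k; have [n _ /=] := xh k I; rewrite in_itv/= andbT; exists n.
Qed.

Lemma birkhoff_unbounded_invariant h :
  T @^-1` birkhoff_unbounded h = birkhoff_unbounded h.
Proof.
apply/seteqP; split=> x xh k.
- have [l _ /(_ l (leqnn _)) /= lk] := nbhs_infty_ger (k%:R - h x)%R.
  have [n ln] := xh l.
  exists n.+1; rewrite /= -lerBlDl le_max; apply/orP; right.
  exact: le_trans ln.
- have [l _ /(_ l (leqnn _)) /= lk] := nbhs_infty_ger (k%:R + h x)%R.
  have [n ln] := xh l.+1.
  have {}ln := le_trans ln (birkhoff_max_nd h x (leqnSn n)).
  exists n; move: ln; rewrite /= -natr1.
  have k0 : (0 <= k%:R :> R)%R by [].
  by case: (lerP 0 (birkhoff_max h n (T x))); lra.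
Qed.

(** Suppose the maxima are unbounded almost everywhere.  Then
    birkhoff_max (n+1) - birkhoff_max n o T = h + max 0 (- birkhoff_max n o T)
    tends to h and is dominated by |h| + |h o T|; its integral is nonnegative
    since T preserves the measure and the maxima increase.  So the integral of h
    is nonnegative.  By ergodicity this is the only alternative to boundedness. *)
Lemma birkhoff_max_bounded h : mu.-integrable setT (EFin \o h) ->
  \int[mu]_x (h x)%:E < 0 ->
  {ae mu, forall x, exists k : nat, forall n, (birkhoff_max h n x < k%:R)%R}.
Proof.
move=> ih h0; have mh := measurable_int _ ih; move/measurable_EFinP : mh => mh.
have mF := measurable_birkhoff_unbounded mh.
have [F0|F1] := T_ergodic mF (birkhoff_unbounded_invariant h).
  exists (birkhoff_unbounded h); split=> // x /= xk k.
  apply: contrapT => nk; apply: xk; exists k => n.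
  by rewrite ltNge; apply/negP => kn; apply: nk; exists n.
exfalso; move: h0; apply/negP; rewrite -leNgt.
pose g n x := (birkhoff_max h n.+1 x - birkhoff_max h n (T x))%R.
have ig n : mu.-integrable setT (EFin \o g n).
  have := integrableB measurableT (integrable_birkhoff_max n.+1 ih)
    (integrable_preserved (integrable_birkhoff_max n ih)).1.
  by apply: eq_integrable => // x _ /=; rewrite EFinB.
have ig0 n : 0 <= \int[mu]_x (g n x)%:E.
  under eq_integral do rewrite EFinB.
  rewrite (integralB measurableT (integrable_birkhoff_max n.+1 ih)
    (integrable_preserved (integrable_birkhoff_max n ih)).1)/=.
  have [_ ->] := integrable_preserved (integrable_birkhoff_max n ih).
  rewrite sube_ge0; last first.
    by rewrite (integrable_fin_num _ (integrable_birkhoff_max n ih)).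
  apply: (le_integral measurableT (integrable_birkhoff_max n ih)
    (integrable_birkhoff_max n.+1 ih)).
  by move=> x _; rewrite lee_fin birkhoff_max_nd.
have gE n x : g n x = (h x + Num.max 0 (- birkhoff_max h n (T x)))%R.
  rewrite /g/=; case: (lerP 0 (birkhoff_max h n (T x))) => u0.
    by rewrite max_l; lra.
  by rewrite max_r; lra.
have [_ _ cvg_g] : [/\ mu.-integrable setT (EFin \o h),
    \int[mu]_x `|(g n x)%:E - (h x)%:E| @[n --> \oo] --> 0 &
    \int[mu]_x (g n x)%:E @[n --> \oo] --> \int[mu]_x (h x)%:E].
  apply: (@dominated_convergence _ _ _ mu setT measurableT
    (fun n => EFin \o g n) (EFin \o h) (fun x => `|(h x)%:E| + `|(h (T x))%:E|)).
  - by move=> n; exact: measurable_int (ig n).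
  - exact/measurable_EFinP.
  - exists (~` birkhoff_unbounded h); split.
    + exact: measurableC.
    + have := probability_setC mu mF; rewrite F1 subee// => ->.
    + move=> x /= + xF; apply => _.
      rewrite -birkhoff_unbounded_invariant in xF.
      have [n n0] := xF 0%N.
      apply: cvg_near_cst; near=> m; rewrite gE; congr _%:E.
      rewrite max_l ?addr0// oppr_le0 (le_trans n0)//.
      by apply: birkhoff_max_nd; near: m; exact: nbhs_infty_ge.
  - apply: integrableD => //; apply: integrable_abse => //.
    exact: (integrable_preserved ih).1.
  - apply: aeW => x n _ /=; rewrite gE lee_fin.
    rewrite (le_trans (ler_normD _ _))// lerD2l.
    case: (lerP 0 (- birkhoff_max h n (T x))) => u0; last by rewrite normr0.
    rewrite ler_norml; apply/andP; split; last first.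
      have := birkhoff_max_nd h (T x) (leq0n n) => /=.
      by have := ler_norm (- h (T x)); rewrite normrN; lra.
    by rewrite (le_trans _ u0)// oppr_le0.
rewrite -(cvg_lim _ cvg_g)//; apply: lime_ge; first by apply/cvg_ex; eexists; exact: cvg_g.
exact: nearW.
Unshelve. all: by end_near. Qed.

(** Apply the previous lemma to the deviations h - E h and E h - h, each lowered
    by 1/(j+1) so that its integral is negative: bounded partial sums leave no
    room for a deviation of the averages larger than 1/(j+1) in the limit. *)
Theorem birkhoff h : mu.-integrable setT (EFin \o h) ->
  {ae mu, forall x,
    (n%:R^-1 * birkhoff_sum h n x)%R @[n --> \oo] --> \int[mu]_x (h x)}%R.
Proof.
move=> ih; have mh := measurable_int _ ih; move/measurable_EFinP : mh => mh.
set m := (\int[mu]_x (h x))%R.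
have mE : \int[mu]_x (h x)%:E = m%:E by rewrite fineK// integrable_fin_num.
pose dev (s : R) j x : R := (s * (h x - m) - j.+1%:R^-1)%R.
have ic c : mu.-integrable setT (EFin \o cst c : S -> \bar R).
  exact: finite_measure_integrable_cst.
have Ec c : \int[mu]_x (EFin \o cst c) x = c%:E.
  by rewrite (integral_cst _ _ c%:E)//= probability_setT mule1.
have ihm : mu.-integrable setT (fun x => (h x)%:E - m%:E).
  by have := integrableB measurableT ih (ic m); apply: eq_integrable.
have idev s j : mu.-integrable setT (EFin \o dev s j).
  have := integrableB measurableT (integrableZl measurableT s ihm) (ic j.+1%:R^-1%R).
  by apply: eq_integrable.
have ldev s j : \int[mu]_x (dev s j x)%:E < 0.
  have -> := integralB measurableT (integrableZl measurableT s ihm) (ic j.+1%:R^-1%R).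
  rewrite integralZl// (integralB measurableT ih (ic m)) mE !Ec.
  rewrite subee// mule0 add0e.
  by rewrite oppe_lt0 lte_fin invr_gt0.
have sum_dev s j n x : birkhoff_sum (dev s j) n x =
    (s * (birkhoff_sum h n x - n%:R * m) - n%:R * j.+1%:R^-1)%R.
  rewrite /birkhoff_sum /dev sumrB -mulr_sumr sumrB !sumr_const card_ord.
  by rewrite !mulr_natl.
have both : {ae mu, forall x j,
    (exists k : nat, forall n, (birkhoff_max (dev 1 j) n x < k%:R)%R) /\
    (exists k : nat, forall n, (birkhoff_max (dev (-1) j) n x < k%:R)%R)}.
  apply: ae_foralln => j.
  apply: filterS2 (birkhoff_max_bounded (idev 1%R j) (ldev 1%R j))
     (birkhoff_max_bounded (idev (-1)%R j) (ldev (-1)%R j)).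
  by move=> x.
apply: filterS both => x bx.
suff close (e : R) : (0 < e)%R ->
    \forall n \near \oo, (`|m - n%:R^-1 * birkhoff_sum h n x| <= e)%R.
  exact/cvgrPdist_le.
move=> e0.
have [j je] : exists j : nat, (j.+1%:R^-1 <= e / 2)%R.
  have [j _ /(_ j (leqnn _)) /= je] := @near_infty_natSinv_lt R (PosNum (divr_gt0 e0 (ltr0n R 2))).
  by exists j; exact: ltW.
have [[k1 H1] [k2 H2]] := bx j.
pose k := (k1 + k2)%N.
near=> n.
have n0 : (0 < n)%N by near: n; exact: nbhs_infty_gt.
have n0' : (0 < n%:R :> R)%R by rewrite ltr0n.
have kn : (k%:R <= e / 2 * n%:R)%R.
  rewrite -ler_pdivrMl ?divr_gt0//; near: n; exact: nbhs_infty_ger.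
have k1k : (k1%:R <= k%:R :> R)%R by rewrite ler_nat leq_addr.
have k2k : (k2%:R <= k%:R :> R)%R by rewrite ler_nat leq_addl.
have B1 := le_lt_trans (birkhoff_sum_le_max _ _ _) (H1 n.-1).
have B2 := le_lt_trans (birkhoff_sum_le_max _ _ _) (H2 n.-1).
rewrite prednK// !sum_dev in B1 B2.
have nj : (n%:R * j.+1%:R^-1 <= n%:R * (e / 2))%R by rewrite ler_pM2l.
rewrite -(ler_pM2l n0') -[X in (X * `|_|)%R]gtr0_norm// -normrM mulrBr mulVKf ?gt_eqF//.
rewrite ler_norml; move: B1 B2 nj kn k1k k2k.
move: (birkhoff_sum h n x) (n%:R : R)%R (j.+1%:R^-1 : R)%R (k%:R : R)%R => s r q l.
by move=> *; apply/andP; split; nra.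
Unshelve. all: by end_near. Qed.

End Birkhoff.

(** * Ergodic averages along a stationary process *)
Section ergodic_process.
Context d d' (Omega : measurableType d) (T : measurableType d') (R : realType).
Variables (Pr : probability Omega R) (X : int -> {RV Pr >-> T}).
Hypotheses (statX : stationary X) (ergX : ergodic X).
Variable P : probability T R.
Hypothesis PE : forall E, measurable E -> P E = distribution Pr (X 1%Z) E.

Definition cylinders : set (set (int -> T)) :=
  \bigcup_i preimage_set_system setT (fun x : int -> T => x i) measurable.

Local Notation pathType := (g_sigma_algebraType cylinders).

Lemma measurable_to_paths d1 (U : measurableType d1) (f : U -> pathType) :
  (forall i, measurable_fun setT (fun u => f u i)) -> measurable_fun setT f.
Proof.
move=> mf; apply: (@measurability _ _ U pathType setT f cylinders) => //.
move=> _ [_ [i _ [B mB <-]] <-].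
rewrite (_ : _ `&` _ = setT `&` (fun u => f u i) @^-1` B).
  exact: mf.
by apply/seteqP; split=> u [] // _ [].
Qed.

Lemma measurable_coordinate i : measurable_fun setT (fun x : pathType => x i).
Proof.
move=> _ B mB; apply: sub_sigma_algebra; exists i => //.
by exists B.
Qed.

Lemma measurable_shift : measurable_fun setT (@Defs.shift d' T : pathType -> pathType).
Proof. by apply: measurable_to_paths => i; exact: measurable_coordinate. Qed.

Lemma measurable_path : measurable_fun setT (Defs.path X : Omega -> pathType).
Proof. by apply: measurable_to_paths => i; exact: measurable_funPT. Qed.

HB.instance Definition _ :=
  isMeasurableFun.Build _ _ _ _ (Defs.path X : Omega -> pathType) measurable_path.

Definition path_law : probability pathType R :=
  distribution Pr (Defs.path X : Omega -> pathType).

Lemma iter_shift n (x : int -> T) i : iter n (@Defs.shift d' T) x i = x (i + n%:Z)%R.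
Proof.
elim: n i => [|n IH] i /=; first by rewrite addr0.
by rewrite /Defs.shift IH -addrA -intS.
Qed.

(** Stationarity and ergodicity are properties of the law of the path, so the
    ergodic theorem is applied to the shift on path space and then pulled back
    along the path map. *)
Theorem ergodic_averages (h : T -> R) : P.-integrable setT (EFin \o h) ->
  {ae Pr, forall w,
    (n%:R^-1 * \sum_(i < n) h (X (i.+1)%:Z w))%R @[n --> \oo] -->
    \int[P]_x (h x)}%R.
Proof.
move=> /integrableP[/measurable_EFinP mh ih].
pose H (x : pathType) := h (x 1%Z).
have mH : measurable_fun setT H.
  exact: measurableT_comp mh (measurable_coordinate 1%Z).
have PX (g : T -> \bar R) : measurable_fun setT g -> (forall x, 0 <= g x) ->
    \int[P]_x g x = \int[path_law]_x g (x 1%Z).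
  move=> mg g0.
  have mg1 : measurable_fun setT (fun x : pathType => g (x 1%Z)).
    exact: measurableT_comp mg (measurable_coordinate 1%Z).
  have -> : \int[P]_x g x = \int[distribution Pr (X 1%Z)]_x g x.
    by apply: eq_measure_integral => E mE _; exact: PE.
  have /= -> // := ge0_integral_pushforward (measurable_funPT (X 1%Z)) Pr measurableT mg.
  by have /= -> // := ge0_integral_pushforward measurable_path Pr measurableT mg1.
have iH : path_law.-integrable setT (EFin \o H).
  apply/integrableP; split; first exact/measurable_EFinP.
  by rewrite /= -(PX (fun x => `|(h x)%:E|))//; exact/measurableT_comp/measurable_EFinP.
have -> : (\int[P]_x h x = \int[path_law]_x H x)%R.
  congr fine; rewrite integralE [RHS]integralE; congr (_ - _).
    rewrite PX//; first by apply: eq_integral => x _; rewrite !funeposE.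
    by apply: measurable_funepos; exact/measurable_EFinP.
  rewrite PX//; first by apply: eq_integral => x _; rewrite !funenegE.
  by apply: measurable_funeneg; exact/measurable_EFinP.
have [N [mN N0 sN]] := @birkhoff _ pathType R path_law _ measurable_shift
  (fun C mC => statX mC) (fun C mC sC => ergX mC sC) _ iH.
exists (Defs.path X @^-1` N); split => //.
  by rewrite -[X in measurable X]setTI; exact: measurable_path.
have sumE w n : (\sum_(i < n) h (X (i.+1)%:Z w) =
    @birkhoff_sum _ pathType R (@Defs.shift d' T) H n (Defs.path X w))%R.
  by apply: eq_bigr => i _; rewrite /H iter_shift /Defs.path intS.
move=> w /= nw; apply: sN => /= lim_w; apply: nw.
by under eq_fun do rewrite sumE.
Qed.

End ergodic_process.

(** * Free energy and Gibbs mean of one random variable *)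
Section gibbs.
Context d (T : measurableType d) (R : realType) (Q : probability T R).
Variable r : T -> R.
Implicit Types b c : R.
Hypotheses (mr : measurable_fun setT r) (r_ge0 : forall y, (0 <= r y)%R).

Definition laplace (b : R) : R := (\int[Q]_y expR (- (b * r y)))%R.

(** Minus the logarithmic moment generating function at -b. *)
Definition free_energy (b : R) : R := (- ln (laplace b))%R.

(** The mean of r under Q tilted by exp(-b r), that is, the derivative of
    free_energy at b. *)
Definition gibbs_mean (b : R) : R :=
  ((\int[Q]_y (r y * expR (- (b * r y)))) / laplace b)%R.

Lemma measurable_boltzmann b :
  measurable_fun setT (fun y => expR (- (b * r y)))%R.
Proof.
by apply: measurableT_comp => //; apply: measurable_funN; apply: measurable_funM.
Qed.

Lemma boltzmann_le1 b y : (0 <= b)%R -> (expR (- (b * r y)) <= 1)%R.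
Proof. by move=> b0; rewrite expR_le1 oppr_le0 mulr_ge0. Qed.

Lemma integrable_boltzmann b : (0 <= b)%R ->
  Q.-integrable setT (fun y => (expR (- (b * r y)))%:E).
Proof.
move=> b0; have i1 : Q.-integrable setT (EFin \o cst 1%R : T -> \bar R).
  exact: finite_measure_integrable_cst.
apply: le_integrable i1 => //.
  exact/measurable_EFinP/measurable_boltzmann.
by move=> y _ /=; rewrite lee_fin normr1 ger0_norm ?expR_ge0 ?boltzmann_le1.
Qed.

Lemma laplaceE b : (0 <= b)%R ->
  \int[Q]_y (expR (- (b * r y)))%:E = (laplace b)%:E.
Proof. by move=> b0; rewrite fineK// integrable_fin_num// integrable_boltzmann. Qed.

Lemma laplace_gt0 b : (0 <= b)%R -> (0 < laplace b)%R.
Proof.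
move=> b0; rewrite lt_neqAle Rintegral_ge0 ?andbT; last by move=> *; exact: expR_ge0.
apply/eqP => z0.
have /ae_eq_integral_abs [//||N [mN N0 sN]] : \int[Q]_y `|(expR (- (b * r y)))%:E| = 0.
- by under eq_integral do rewrite gee0_abs ?lee_fin ?expR_ge0//; rewrite laplaceE// -z0.
- exact/measurable_EFinP/measurable_boltzmann.
have NT : N = setT.
  apply/seteqP; split=> // y _; apply: sN => /= /(_ I) [] /eqP.
  by rewrite expR_eq0.
by move: N0; rewrite NT /= probability_setT => -[] /eqP; rewrite oner_eq0.
Qed.

Lemma laplace_le1 b : (0 <= b)%R -> (laplace b <= 1)%R.
Proof.
move=> b0; rewrite -lee_fin -laplaceE//.
apply: (@le_trans _ _ (\int[Q]_y cst 1 y)); last first.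
  by rewrite integral_cst//= probability_setT mule1.
apply: ge0_le_integral => //.
- exact/measurable_EFinP/measurable_boltzmann.
- by move=> y ?; rewrite lee_fin boltzmann_le1.
Qed.

Lemma laplace0 : laplace 0 = 1%R.
Proof.
rewrite /laplace; under eq_Rintegral do rewrite mul0r oppr0 expR0.
by rewrite Rintegral_cst//= probability_setT mul1r.
Qed.

Lemma free_energy0 : free_energy 0 = 0%R.
Proof. by rewrite /free_energy laplace0 ln1 oppr0. Qed.

Lemma free_energy_ge0 b : (0 <= b)%R -> (0 <= free_energy b)%R.
Proof. by move=> b0; rewrite oppr_ge0 ln_le0// laplace_le1. Qed.

Lemma laplaceK b : (0 <= b)%R -> laplace b = expR (- free_energy b).
Proof. by move=> b0; rewrite opprK lnK// posrE laplace_gt0. Qed.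

Lemma ess_inf_le_free_energy b : (0 < b)%R ->
  ess_inf Q (EFin \o r) <= (b^-1 * free_energy b)%:E.
Proof.
move=> b0; rewrite ess_infE//; apply: ge_ereal_sup => _ [t /= Qt <-].
rewrite lee_fin -ler_pdivrMl ?invr_gt0// invrK.
have zb := laplace_gt0 (ltW b0).
suff zt : (laplace b <= expR (- (b * t)))%R.
  by rewrite lerNr -(expRK (- (b * t))%R) ler_ln// posrE expR_gt0.
rewrite -lee_fin -laplaceE ?(ltW b0)//.
apply: (@le_trans _ _ (\int[Q]_y cst (expR (- (b * t)))%:E y)); last first.
  by rewrite integral_cst//= probability_setT mule1.
have mt : measurable [set y | (t < r y)%R].
  rewrite -[X in measurable X]setTI (_ : [set y | _] = r @^-1` `]t, +oo[); first exact: mr.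
  by apply/seteqP; split=> y /=; rewrite in_itv/= andbT.
apply: ae_ge0_le_integral => //.
- exact/measurable_EFinP/measurable_boltzmann.
- by move=> y _; rewrite /= lee_fin expR_ge0.
- exists (~` [set y | (t < r y)%R]); split.
  + exact: measurableC.
  + by have := probability_setC Q mt; rewrite Qt subee// => ->.
  + move=> y /= ny ty; apply: ny => _.
    by rewrite lee_fin ler_expR lerN2 ler_pM2l// ltW.
Qed.

(** The event r <= t has positive probability p, and on it exp(-b r) is at
    least exp(-b t): one may take c = - ln p. *)
Lemma free_energy_upper t : ess_inf Q (EFin \o r) < t%:E ->
  exists c : R, forall b, (0 < b)%R -> (b^-1 * free_energy b <= t + b^-1 * c)%R.
Proof.
rewrite ess_infE// => at_; set E := [set y | (r y <= t)%R].
have mE : measurable E.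
  rewrite -[X in measurable X]setTI (_ : E = r @^-1` `]-oo, t]); first exact: mr.
  by apply/seteqP; split=> y /=; rewrite in_itv.
have QE : 0 < Q E.
  rewrite lt0e measure_ge0 andbT; apply/eqP => QE0.
  move: at_; apply/negP; rewrite -leNgt; apply: ereal_sup_ubound; exists t => //=.
  rewrite (_ : [set y | _] = ~` E); last first.
    by apply/seteqP; split=> y /=; rewrite /E/= ltNge => /negP.
  by have := probability_setC Q mE; rewrite QE0 sube0.
have [p QEp] : exists p, Q E = p%:E.
  by exists (fine (Q E)); rewrite fineK// fin_num_measure.
rewrite QEp lte_fin in QE.
exists (- ln p)%R => b b0.
have zb := laplace_gt0 (ltW b0).
rewrite -(ler_pM2l b0) mulrDr !mulVKf ?gt_eqF//.
suff zt : (expR (- (b * t)) * p <= laplace b)%R.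
  rewrite -(ler_ln (mulr_gt0 (expR_gt0 _) QE) zb) lnM ?posrE ?expR_gt0// expRK in zt.
  by rewrite /free_energy; lra.
rewrite -lee_fin -laplaceE ?(ltW b0)//.
have -> : (expR (- (b * t)) * p)%:E = \int[Q]_y (expR (- (b * t)) * \1_E y)%:E.
  under eq_integral do rewrite EFinM.
  rewrite ge0_integralZl_EFin ?expR_ge0 ?integral_indic ?setIT ?EFinM -?QEp//.
  exact/measurable_EFinP/measurable_indic.
apply: ge0_le_integral => //.
- exact/measurable_EFinP/measurable_funM/measurable_indic.
- exact/measurable_EFinP/measurable_boltzmann.
- move=> y _; rewrite lee_fin indicE; case: (boolP (y \in E)) => [|_].
    by rewrite inE /E /= => ry; rewrite mulr1 ler_expR lerN2 ler_pM2l.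
  by rewrite mulr0 expR_ge0.
Qed.

Lemma ess_inf_fin_num : ess_inf Q (EFin \o r) \is a fin_num.
Proof.
have lo : (-1)%:E <= ess_inf Q (EFin \o r).
  rewrite ess_infE//; apply: ereal_sup_ubound; exists (-1)%R => //=.
  rewrite (_ : [set y | _] = setT) ?probability_setT//.
  by apply/seteqP; split=> y //= _; rewrite (lt_le_trans _ (r_ge0 y))// oppr_lt0.
have := ess_inf_le_free_energy (@ltr01 R).
by case: (ess_inf _ _) lo.
Qed.

Lemma free_energy_cvg_ess_inf :
  (k.+1%:R^-1 * free_energy k.+1%:R)%R @[k --> \oo] --> fine (ess_inf Q (EFin \o r)).
Proof.
have [a aE] : exists a, ess_inf Q (EFin \o r) = a%:E.
  by exists (fine (ess_inf Q (EFin \o r))); rewrite fineK// ess_inf_fin_num.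
rewrite aE.
suff close (e : R) : (0 < e)%R ->
    \forall k \near \oo, (`|a - k.+1%:R^-1 * free_energy k.+1%:R| <= e)%R.
  exact/cvgrPdist_le.
move=> e0.
have [c Hc] : exists c : R, forall b, (0 < b)%R ->
    (b^-1 * free_energy b <= a + e / 2 + b^-1 * c)%R.
  by apply: free_energy_upper; rewrite aE lte_fin ltrDl divr_gt0.
near=> k.
have k0 : (0 < k.+1%:R :> R)%R by [].
have ck : (c <= e / 2 * k.+1%:R)%R.
  rewrite -ler_pdivrMl ?divr_gt0// (@le_trans _ _ k%:R)//; last by rewrite ler_nat.
  near: k; exact: nbhs_infty_ger.
have := ess_inf_le_free_energy k0; have := Hc _ k0.
rewrite aE lee_fin => up down.
have kc : (k.+1%:R^-1 * c <= e / 2)%R by rewrite ler_pdivrMl// mulrC.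
rewrite distrC ger0_norm ?subr_ge0// lerBlDl (le_trans up)// -addrA lerD2l.
by rewrite [leRHS](splitr e) lerD2l.
Unshelve. all: by end_near. Qed.

Hypothesis ir : Q.-integrable setT (EFin \o r).

Lemma integrable_energy b : (0 <= b)%R ->
  Q.-integrable setT (fun y => (r y * expR (- (b * r y)))%:E).
Proof.
move=> b0; apply: le_integrable ir => //.
  by apply/measurable_EFinP/measurable_funM => //; exact: measurable_boltzmann.
move=> y _ /=; rewrite lee_fin normrM ler_piMr// ger0_norm ?expR_ge0//.
exact: boltzmann_le1.
Qed.

Lemma gibbs_meanK b : (0 <= b)%R ->
  (\int[Q]_y (r y * expR (- (b * r y))) = gibbs_mean b * laplace b)%R.
Proof. by move=> b0; rewrite /gibbs_mean divfK// gt_eqF// laplace_gt0. Qed.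

(** Concavity in tangent form, which is Jensen's inequality for the tilted law.
    Since exp u >= 1 + u, the function exp(-c r) lies above
    exp(-b r) exp(-(c-b)m) (1 - (c-b)(r-m)); with m = gibbs_mean b the linear
    term integrates to zero. *)
Lemma free_energy_tangent b c : (0 <= b)%R -> (0 <= c)%R ->
  (free_energy c <= free_energy b + (c - b) * gibbs_mean b)%R.
Proof.
move=> b0 c0; set m := gibbs_mean b.
have zb := laplace_gt0 b0; have zc := laplace_gt0 c0.
pose k := expR (- ((c - b) * m)).
suff zz : (k * laplace b <= laplace c)%R.
  have k0 : (0 < k)%R := expR_gt0 _.
  rewrite -(ler_ln (mulr_gt0 k0 zb) zc) lnM// /k expRK in zz.
  rewrite /free_energy; move: zz.
  move: (ln (laplace b)) (ln (laplace c)) ((c - b) * m)%R => u v w.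
  lra.
have i1 := @RintegralZl _ _ _ Q setT _ (k * (1 + (c - b) * m))%R measurableT (integrable_boltzmann b0).
have i2 := @RintegralZl _ _ _ Q setT _ (k * (c - b))%R measurableT (integrable_energy b0).
have ib1 := integrableZl measurableT (k * (1 + (c - b) * m))%R (integrable_boltzmann b0).
have ib2 := integrableZl measurableT (k * (c - b))%R (integrable_energy b0).
have -> : (k * laplace b = \int[Q]_y (k * (1 + (c - b) * m) * expR (- (b * r y)) -
    k * (c - b) * (r y * expR (- (b * r y)))))%R.
  rewrite RintegralB// i1 i2 gibbs_meanK// -/m -/(laplace b); ring.
apply: le_Rintegral => //.
- by have := integrableB measurableT ib1 ib2; apply: eq_integrable.
- exact: integrable_boltzmann.
- move=> y _.
  have -> : (- (c * r y) = - ((c - b) * m) + (- (b * r y) + - ((c - b) * (r y - m))))%R by ring.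
  rewrite !expRD -/k.
  have -> : (k * (1 + (c - b) * m) * expR (- (b * r y)) -
     k * (c - b) * (r y * expR (- (b * r y))) =
     k * (expR (- (b * r y)) * (1 + - ((c - b) * (r y - m)))))%R by ring.
  by rewrite ler_pM2l ?expR_gt0// ler_pM2l ?expR_gt0// expR_ge1Dx.
Qed.

Lemma gibbs_mean0 : gibbs_mean 0 = (\int[Q]_y r y)%R.
Proof.
rewrite /gibbs_mean laplace0 divr1; apply: eq_Rintegral => y _.
by rewrite mul0r oppr0 expR0 mulr1.
Qed.

Lemma gibbs_mean_ge0 b : (0 <= b)%R -> (0 <= gibbs_mean b)%R.
Proof.
move=> b0; rewrite divr_ge0 ?(ltW (laplace_gt0 _))// Rintegral_ge0// => y _.
by rewrite mulr_ge0 ?expR_ge0.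
Qed.

Lemma free_energy_le b : (0 <= b)%R ->
  (free_energy b <= b * (\int[Q]_y r y))%R.
Proof.
move=> b0; have := free_energy_tangent (lexx 0%R) b0.
by rewrite free_energy0 gibbs_mean0 add0r subr0.
Qed.

Lemma gibbs_mean_le_free_energy b : (0 <= b)%R ->
  (b * gibbs_mean b <= free_energy b)%R.
Proof.
move=> b0; have := free_energy_tangent b0 (lexx 0%R).
by rewrite free_energy0; lra.
Qed.

Lemma gibbs_mean_le b : (0 <= b)%R -> (gibbs_mean b <= \int[Q]_y r y)%R.
Proof.
rewrite le_eqVlt => /predU1P[<-|b0]; first by rewrite gibbs_mean0.
rewrite -(ler_pM2l b0) (le_trans (gibbs_mean_le_free_energy (ltW b0)))//.
exact: free_energy_le (ltW b0).
Qed.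

(** Sequential continuity on the closed half line, 0 included: numerator and
    denominator are dominated by r and 1. *)
Lemma gibbs_mean_cvg (b_ : nat -> R) b : (forall n, 0 <= b_ n)%R ->
  b_ n @[n --> \oo] --> b -> gibbs_mean (b_ n) @[n --> \oo] --> gibbs_mean b.
Proof.
move=> b0 bb.
have b_ge0 : (0 <= b)%R.
  by apply: (cvgr_to_ge bb); exact: nearW.
have exp_cvg y : expR (- (b_ n * r y)) @[n --> \oo] --> expR (- (b * r y)).
  apply: continuous_cvg; first exact: continuous_expR.
  by apply: cvgN; apply: cvgMl.
apply: cvgM; last first.
  apply: cvgV; first by rewrite gt_eqF// laplace_gt0.
  apply: fine_cvg; rewrite -laplaceE//.
  have := @dominated_convergence _ _ _ Q setT measurableT
    (fun n y => (expR (- (b_ n * r y)))%:E) (fun y => (expR (- (b * r y)))%:E) (cst 1).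
  case.
  - by move=> n; exact/measurable_EFinP/measurable_boltzmann.
  - exact/measurable_EFinP/measurable_boltzmann.
  - by apply: aeW => y _; apply: cvg_EFin; [exact: nearW|exact: exp_cvg].
  - exact: finite_measure_integrable_cst.
  - by apply: aeW => y n _ /=; rewrite lee_fin ger0_norm ?expR_ge0 ?boltzmann_le1.
  by [].
apply: fine_cvg; rewrite fineK; last first.
  by rewrite integrable_fin_num// integrable_energy.
have := @dominated_convergence _ _ _ Q setT measurableT
  (fun n y => (r y * expR (- (b_ n * r y)))%:E)
  (fun y => (r y * expR (- (b * r y)))%:E) (EFin \o r).
case => //.
- move=> n; apply/measurable_EFinP/measurable_funM => //.
  exact: measurable_boltzmann.
- by apply/measurable_EFinP/measurable_funM => //; exact: measurable_boltzmann.
- apply: aeW => y _; apply: cvg_EFin; first exact: nearW.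
  by apply: cvgMr; exact: exp_cvg.
- apply: aeW => y n _ /=; rewrite lee_fin normrM ger0_norm// ler_piMr//.
  by rewrite ger0_norm ?expR_ge0 ?boltzmann_le1.
Qed.

End gibbs.

(** * Averages of the free energy over the source *)

(** On the half line, continuity at 0 is one-sided; composing with the absolute
    value turns it into continuity on the whole line. *)
Lemma sequential_IVT (R : realType) (f : R -> R) (b0 v : R) :
  (forall (u : nat -> R) b, (forall n, 0 <= u n)%R ->
    u n @[n --> \oo] --> b -> f (u n) @[n --> \oo] --> f b) ->
  (0 <= b0)%R -> (f b0 < v)%R -> (v < f 0)%R ->
  exists b, [/\ (0 < b)%R, (b < b0)%R & f b = v].
Proof.
move=> cf b0_ge0 fb0 f0.
have cM : continuous (fun b : R => f `|b|%R).
  move=> b; apply/(@cvg_nbhsP _ R^o) => u ub.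
  by apply: cf => //; apply: cvg_norm.
have [|b bb0 bD] := IVT b0_ge0 (continuous_subspaceT cM) (v := v).
  by rewrite normr0 ger0_norm// ge_min le_max (ltW fb0) (ltW f0) orbT.
move: bb0; rewrite in_itv/= => /andP[b_ge0 bb0].
rewrite ger0_norm// in bD.
exists b; split => //; rewrite lt_neqAle ?b_ge0 ?bb0 andbT; apply/eqP => bE.
  by move: f0; rewrite bE bD ltxx.
by move: fb0; rewrite -bE bD ltxx.
Qed.

Section ae_integral.
Context d (T : measurableType d) (R : realType) (mu : {measure set T -> \bar R}).
Implicit Types f g : T -> R.

Lemma ae_le_integrable f g : measurable_fun setT f ->
  {ae mu, forall x, `|f x| <= `|g x|}%R -> mu.-integrable setT (EFin \o g) ->
  mu.-integrable setT (EFin \o f).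
Proof.
move=> mf fg /integrableP[mg ig]; apply/integrableP; split.
  exact/measurable_EFinP.
apply: le_lt_trans ig; apply: ae_ge0_le_integral => //.
- exact/measurableT_comp/measurable_EFinP.
- exact/measurableT_comp.
- by apply: filterS fg => x fgx _; rewrite lee_fin.
Qed.

Lemma ae_le_Rintegral f g :
  mu.-integrable setT (EFin \o f) -> mu.-integrable setT (EFin \o g) ->
  {ae mu, forall x, f x <= g x}%R -> (\int[mu]_x f x <= \int[mu]_x g x)%R.
Proof.
move=> fi gi fg; rewrite -subr_ge0 -RintegralB//.
rewrite (_ : Rintegral _ _ _ = \int[mu]_x `|g x - f x|)%R; last first.
  have mgf : measurable_fun setT (fun x => (g x - f x)%:E).
    exact: measurable_int (integrableB measurableT gi fi).
  congr fine; apply: ae_eq_integral => //.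
    exact: (measurableT_comp (measurable_int _ (integrable_abse (integrableB measurableT gi fi)))).
  by apply: filterS fg => x fgx _; rewrite ger0_norm// subr_ge0.
by apply: Rintegral_ge0 => x _; exact: normr_ge0.
Qed.

Lemma dominated_Rintegral_cvg (f_ : nat -> T -> R) f g :
  (forall n, measurable_fun setT (f_ n)) -> measurable_fun setT f ->
  {ae mu, forall x, f_ n x @[n --> \oo] --> f x} ->
  mu.-integrable setT (EFin \o g) ->
  {ae mu, forall x n, `|f_ n x| <= g x}%R ->
  mu.-integrable setT (EFin \o f) /\
  (\int[mu]_x f_ n x @[n --> \oo] --> \int[mu]_x f x)%R.
Proof.
move=> mf_ mf f_f ig fg.
have := @dominated_convergence _ _ _ mu setT measurableT
  (fun n => EFin \o f_ n) (EFin \o f) (EFin \o g).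
case => //.
- by move=> n; exact/measurable_EFinP.
- exact/measurable_EFinP.
- apply: filterS f_f => x f_fx _.
  by apply: cvg_EFin; [exact: nearW|exact: f_fx].
- by apply: filterS fg => x fgx n _; rewrite lee_fin.
move=> fi _ cvgf; split => //; apply: fine_cvg.
by rewrite fineK//; exact: integrable_fin_num.
Qed.

End ae_integral.

Section mean_free_energy.
Context d1 d2 (A : measurableType d1) (B : measurableType d2) (R : realType).
Variables (P : probability A R) (Q : probability B R) (rho : A * B -> R).
Hypotheses (rho_ge0 : forall z, (0 <= rho z)%R) (mrho : measurable_fun setT rho).
Implicit Types (b c : R) (x : A).

Local Notation section x := (fun y => rho (x, y)).

Definition mean_free_energy b : R :=
  (\int[P]_x free_energy Q (section x) b)%R.

Definition mean_distortion b : R :=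
  (\int[P]_x gibbs_mean Q (section x) b)%R.

Let msection x : measurable_fun setT (section x).
Proof. exact: measurable_fun_pair2. Qed.

Let section_ge0 x y : (0 <= rho (x, y))%R. Proof. exact: rho_ge0. Qed.

Lemma measurable_section_integral (f : A * B -> R) : measurable_fun setT f ->
  (forall z, (0 <= f z)%R) ->
  measurable_fun setT (fun x => \int[Q]_y f (x, y))%R.
Proof.
move=> mf f0.
apply: (measurableT_comp (fine_measurable measurableT)).
apply: (measurable_fun_fubini_tonelli_F (EFin \o f)); first exact/measurable_EFinP.
by move=> z; rewrite lee_fin.
Qed.

Let mexp b : measurable_fun setT (fun z => expR (- (b * rho z)))%R.
Proof.
by apply: measurableT_comp => //; apply: measurable_funN; apply: measurable_funM.
Qed.

Lemma measurable_laplace b : measurable_fun setT (fun x => laplace Q (section x) b).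
Proof. by apply: (measurable_section_integral (mexp b)) => z; exact: expR_ge0. Qed.

Lemma measurable_free_energy b :
  measurable_fun setT (fun x => free_energy Q (section x) b).
Proof.
by apply: measurable_funN; apply: measurableT_comp => //; exact: measurable_laplace.
Qed.

Lemma measurable_gibbs_mean b : (0 <= b)%R ->
  measurable_fun setT (fun x => gibbs_mean Q (section x) b).
Proof.
move=> b0; pose g z : R := (rho z * expR (- (b * rho z)))%R.
rewrite (_ : (fun x => _) = (fun x => (\int[Q]_y g (x, y)) *
    expR (free_energy Q (section x) b))%R); last first.
  apply/funext => x; rewrite /gibbs_mean {1}laplaceK//.
  by rewrite expRN invrK.
apply: measurable_funM.
  apply: measurable_section_integral; first exact: measurable_funM.
  by move=> z; rewrite mulr_ge0 ?expR_ge0.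
by apply: measurableT_comp => //; exact: measurable_free_energy.
Qed.

Hypothesis irho : (P \x Q).-integrable setT (EFin \o rho).

Let ae_section : {ae P, forall x, Q.-integrable setT (EFin \o section x)}.
Proof. exact: ae_integrable1 irho. Qed.

Let e x : R := (\int[Q]_y rho (x, y))%R.

Let e_ge0 x : (0 <= e x)%R. Proof. exact: Rintegral_ge0. Qed.

Lemma integrable_section_mean : P.-integrable setT (EFin \o e).
Proof.
have := integrable_fubini_F irho; apply: le_integrable => //.
  by apply/measurable_EFinP; exact: measurable_section_integral.
move=> x _; rewrite /e /Rintegral /fubini_F /=.
by case: (\int[Q]_y _) => //= *; rewrite ?lexx ?leey.
Qed.

Lemma integrable_free_energy b : (0 <= b)%R ->
  P.-integrable setT (EFin \o (fun x => free_energy Q (section x) b)).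
Proof.
move=> b0; apply: (@ae_le_integrable _ _ _ _ _ (fun x => b * e x)%R).
- exact: measurable_free_energy.
- apply: filterS ae_section => x ix.
  by rewrite !ger0_norm ?mulr_ge0 ?free_energy_ge0// free_energy_le.
- by have := integrableZl measurableT b integrable_section_mean; apply: eq_integrable.
Qed.

Lemma integrable_gibbs_mean b : (0 <= b)%R ->
  P.-integrable setT (EFin \o (fun x => gibbs_mean Q (section x) b)).
Proof.
move=> b0; apply: (@ae_le_integrable _ _ _ _ _ e).
- exact: measurable_gibbs_mean.
- apply: filterS ae_section => x ix.
  by rewrite !ger0_norm ?gibbs_mean_ge0// gibbs_mean_le.
- exact: integrable_section_mean.
Qed.

Lemma mean_free_energy_tangent b c : (0 <= b)%R -> (0 <= c)%R ->
  (mean_free_energy c <= mean_free_energy b + (c - b) * mean_distortion b)%R.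
Proof.
move=> b0 c0.
have i1 := integrable_free_energy b0.
have i2 := integrableZl measurableT (c - b)%R (integrable_gibbs_mean b0).
rewrite -RintegralZl//; last exact: integrable_gibbs_mean.
rewrite -RintegralD//; apply: ae_le_Rintegral.
- exact: integrable_free_energy.
- by have := integrableD measurableT i1 i2; apply: eq_integrable.
- by apply: filterS ae_section => x ix; exact: free_energy_tangent.
Qed.

Lemma mean_distortion_cvg (b_ : nat -> R) b : (forall n, 0 <= b_ n)%R ->
  b_ n @[n --> \oo] --> b -> mean_distortion (b_ n) @[n --> \oo] --> mean_distortion b.
Proof.
move=> b0 bb.
apply: (@dominated_Rintegral_cvg _ _ _ P
  (fun n x => gibbs_mean Q (section x) (b_ n)) _ e _ _ _ _ _).2.
- by move=> n; exact: measurable_gibbs_mean.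
- by apply: measurable_gibbs_mean; apply: (cvgr_to_ge bb); exact: nearW.
- by apply: filterS ae_section => x ix; exact: gibbs_mean_cvg.
- exact: integrable_section_mean.
- apply: filterS ae_section => x ix n.
  by rewrite ger0_norm ?gibbs_mean_ge0// gibbs_mean_le.
Qed.

Lemma mean_distortion0 : (mean_distortion 0)%:E = Dav rho P Q.
Proof.
rewrite /Dav -integral12_prod_meas1//.
rewrite fineK; last by rewrite integrable_fin_num// integrable_gibbs_mean.
apply: ae_eq_integral => //.
- exact/measurable_EFinP/measurable_gibbs_mean.
- exact: measurable_int (integrable_fubini_F irho).
- apply: filterS ae_section => x ix _.
  by rewrite gibbs_mean0 fineK// integrable_fin_num.
Qed.

Lemma mean_distortion_le_free_energy b : (0 < b)%R ->
  (mean_distortion b <= b^-1 * mean_free_energy b)%R.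
Proof.
move=> b0; rewrite -RintegralZl//; last exact: integrable_free_energy (ltW b0).
apply: ae_le_Rintegral; first exact: integrable_gibbs_mean (ltW b0).
  by have := integrableZl measurableT b^-1%R (integrable_free_energy (ltW b0));
    apply: eq_integrable.
apply: filterS ae_section => x ix.
by rewrite ler_pdivlMl// gibbs_mean_le_free_energy// ltW.
Qed.

(** The bound M(b) <= G(b)/b reduces the claim to the convergence of G(b)/b to
    Dmin, which follows from the pointwise convergence of U(x,b)/b to the
    essential infimum, under the domination by the mean of rho(x,Y). *)
Lemma mean_distortion_lt (D : R) : Dmin rho P Q < D%:E ->
  exists2 b : R, (0 < b)%R & (mean_distortion b < D)%R.
Proof.
move=> DD.
pose f k x : R := (k.+1%:R^-1 * free_energy Q (section x) k.+1%:R)%R.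
pose a x : R := fine (ess_inf Q (EFin \o section x)).
have fa x : f k x @[k --> \oo] --> a x by exact: free_energy_cvg_ess_inf.
have mf k : measurable_fun setT (f k).
  by apply: measurable_funM => //; exact: measurable_free_energy.
have [ia cvgf] : P.-integrable setT (EFin \o a) /\
    (\int[P]_x f k x @[k --> \oo] --> \int[P]_x a x)%R.
  apply: (@dominated_Rintegral_cvg _ _ _ P f a e) => //.
  - by apply: (measurable_fun_cvg mf) => // x _; exact: fa.
  - exact: aeW.
  - exact: integrable_section_mean.
  - apply: filterS ae_section => x ix k.
    rewrite ger0_norm ?mulr_ge0 ?free_energy_ge0// ler_pdivrMl//.
    exact: free_energy_le.
have aD : (\int[P]_x a x < D)%R.
  rewrite -lte_fin fineK; last exact: integrable_fin_num.
  apply: le_lt_trans DD; rewrite le_eqVlt; apply/orP; left; apply/eqP.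
  by apply: eq_integral => x _; rewrite /a fineK// ess_inf_fin_num.
have [k _ /(_ k (leqnn k)) /= kD] := cvgr_lt _ cvgf _ aD.
exists k.+1%:R => //; apply: le_lt_trans kD.
rewrite (le_trans (mean_distortion_le_free_energy _))// /f RintegralZl//.
exact: integrable_free_energy.
Qed.

Lemma mean_distortion_surj (b0 D : R) : (0 <= b0)%R -> (mean_distortion b0 < D)%R ->
  D%:E < Dav rho P Q ->
  exists b, [/\ (0 < b)%R, (b < b0)%R & mean_distortion b = D].
Proof.
move=> b0_ge0 b0D; rewrite -mean_distortion0 lte_fin => D0.
exact: (sequential_IVT mean_distortion_cvg b0_ge0 b0D D0).
Qed.

End mean_free_energy.

(** * Exponential bounds for sums of independent terms *)
Section exponential_bounds.
Context d (T : measurableType d) (R : realType) (mu : probability T R).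
Variable S : T -> R.
Hypotheses (mS : measurable_fun setT S) (S_ge0 : forall y, (0 <= S y)%R).
Implicit Types b s : R.

Let msub s : measurable [set y | (S y <= s)%R].
Proof.
rewrite -[X in measurable X]setTI (_ : [set y | _] = S @^-1` `]-oo, s]); first exact: mS.
by apply/seteqP; split=> y /=; rewrite in_itv.
Qed.

Lemma chernoff_upper b s : (0 <= b)%R ->
  mu [set y | (S y <= s)%R] <= (expR (b * s - free_energy mu S b))%:E.
Proof.
move=> b0; set E := [set y | _].
rewrite expRD -laplaceK// EFinM -laplaceE//.
have mexp := measurable_boltzmann mS b.
rewrite -ge0_integralZl_EFin ?expR_ge0//; last exact/measurable_EFinP.
have <- : \int[mu]_y (\1_E y)%:E = mu E.
  by rewrite integral_indic ?setIT//; exact: msub.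
apply: ge0_le_integral => //.
- exact/measurable_EFinP/measurable_indic/msub.
- exact/measurable_funeM/measurable_EFinP.
- move=> y _; rewrite -EFinM -expRD lee_fin indicE; case: (boolP (y \in E)) => [|_].
    rewrite inE /E/= => Sy; rewrite -[leLHS]expR0 ler_expR -mulrBr mulr_ge0//.
    by rewrite subr_ge0.
  exact: expR_ge0.
Qed.

(** A change of measure written without the changed measure: pointwise,
    exp(-b2 S) is at most exp(-b2 s0) when s0 < S <= s, at most
    exp(-b3 S - (b2-b3)s) when S > s, and at most exp(-b1 S + (b1-b2)s0) when
    S <= s0.  Integration gives the claim. *)
Lemma tilting_lower b1 b2 b3 s0 s : (0 <= b3)%R -> (b3 <= b2)%R -> (b2 <= b1)%R ->
  (expR (- free_energy mu S b2) <=
   expR (- (b2 * s0)) * fine (mu [set y | S y <= s]) +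
   expR (- free_energy mu S b3 - (b2 - b3) * s) +
   expR (- free_energy mu S b1 + (b1 - b2) * s0))%R.
Proof.
move=> b3_ge0 b32 b21.
have b2_ge0 := le_trans b3_ge0 b32; have b1_ge0 := le_trans b2_ge0 b21.
set E := [set y | _].
have mE : measurable E := msub s.
have m1 := measurable_boltzmann mS b1.
have m3 := measurable_boltzmann mS b3.
pose f1 y := (expR (- (b2 * s0)) * \1_E y)%R.
pose f2 y := (expR (- ((b2 - b3) * s)) * expR (- (b3 * S y)))%R.
pose f3 y := (expR ((b1 - b2) * s0) * expR (- (b1 * S y)))%R.
have mf1 : measurable_fun setT (EFin \o f1).
  exact/measurable_EFinP/measurable_funM/measurable_indic.
have mf2 : measurable_fun setT (EFin \o f2).
  exact/measurable_EFinP/measurable_funM.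
have mf3 : measurable_fun setT (EFin \o f3).
  exact/measurable_EFinP/measurable_funM.
have E1 : \int[mu]_y (f1 y)%:E = (expR (- (b2 * s0)) * fine (mu E))%:E.
  under eq_integral do rewrite EFinM.
  rewrite ge0_integralZl_EFin ?expR_ge0 ?integral_indic ?setIT//.
    by rewrite EFinM fineK// fin_num_measure.
  exact/measurable_EFinP/measurable_indic.
have E2 : \int[mu]_y (f2 y)%:E = (expR (- free_energy mu S b3 - (b2 - b3) * s))%:E.
  under eq_integral do rewrite EFinM.
  rewrite ge0_integralZl_EFin ?expR_ge0//; last exact/measurable_EFinP.
  by rewrite laplaceE// -EFinM laplaceK// -expRD addrC.
have E3 : \int[mu]_y (f3 y)%:E = (expR (- free_energy mu S b1 + (b1 - b2) * s0))%:E.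
  under eq_integral do rewrite EFinM.
  rewrite ge0_integralZl_EFin ?expR_ge0//; last exact/measurable_EFinP.
  by rewrite laplaceE// -EFinM laplaceK// -expRD addrC.
have f1_ge0 y : (0 <= f1 y)%R by rewrite mulr_ge0 ?expR_ge0.
have f2_ge0 y : (0 <= f2 y)%R by rewrite mulr_ge0 ?expR_ge0.
have f3_ge0 y : (0 <= f3 y)%R by rewrite mulr_ge0 ?expR_ge0.
rewrite -lee_fin -laplaceK// -laplaceE// EFinD EFinD -E1 -E2 -E3.
rewrite -ge0_integralD//; last 2 first.
- by move=> y _; rewrite lee_fin.
- by move=> y _; rewrite lee_fin.
rewrite -ge0_integralD//; last 3 first.
- by move=> y _; rewrite -EFinD lee_fin addr_ge0.
- exact: emeasurable_funD.
- by move=> y _; rewrite lee_fin.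
apply: ge0_le_integral => //.
- exact/measurable_EFinP/measurable_boltzmann.
- by apply: emeasurable_funD => //; exact: emeasurable_funD.
- move=> y _; rewrite -!EFinD lee_fin.
  have [Sy|Sy] := lerP (S y) s0.
    rewrite -[leLHS]add0r lerD ?addr_ge0// /f3 -expRD ler_expR.
    have := ler_wpM2l (_ : 0 <= b1 - b2)%R Sy; rewrite subr_ge0 => /(_ b21); lra.
  have [Sy'|Sy'] := lerP (S y) s.
    rewrite -[leLHS]addr0 lerD// -[leLHS]addr0 lerD// /f1 indicE mem_set// mulr1.
    by rewrite ler_expR lerN2 ler_wpM2l// ltW.
  rewrite -[leLHS]addr0 lerD// -[leLHS]add0r lerD// /f2 -expRD ler_expR.
  have := ler_wpM2l (_ : 0 <= b2 - b3)%R (ltW Sy'); rewrite subr_ge0 => /(_ b32); lra.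
Qed.

End exponential_bounds.

Section power_free_energy.
Context d (T : measurableType d) (R : realType) (Q : probability T R).

Definition coordinate_sum n (r : 'I_n -> T -> R) (y : n.-tuple T) : R :=
  (\sum_(i < n) r i (tnth y i))%R.

Lemma measurable_coordinate_sum n (r : 'I_n -> T -> R) :
  (forall i, measurable_fun setT (r i)) -> measurable_fun setT (coordinate_sum r).
Proof.
move=> mr; apply: measurable_sum => i.
exact: measurableT_comp (mr i) (measurable_tnth i).
Qed.

Lemma laplace_power n (r : 'I_n -> T -> R) (b : R) : (0 <= b)%R ->
  (forall i, measurable_fun setT (r i)) -> (forall i y, (0 <= r i y)%R) ->
  \int[power_measure Q n]_y (expR (- (b * coordinate_sum r y)))%:E =
  (expR (- \sum_(i < n) free_energy Q (r i) b))%:E.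
Proof.
move=> b0; elim: n r => [|n IH] r mr r0.
  rewrite integral_dirac//; last first.
    apply/measurable_EFinP.
    exact: measurable_boltzmann (measurable_coordinate_sum mr) b.
  by rewrite diracT mul1e /coordinate_sum !big_ord0 mulr0.
have mexp := measurable_boltzmann (measurable_coordinate_sum mr) b.
rewrite ge0_integral_pushforward//; last exact/measurable_EFinP.
rewrite preimage_setT.
pose r' i := r (lift ord0 i).
have mexp' := measurable_boltzmann (measurable_coordinate_sum (fun i => mr (lift ord0 i))) b.
have mexp0 := measurable_boltzmann (mr ord0) b.
have totalE z : (expR (- (b * coordinate_sum r (cons_pair z))))%:E =
    (expR (- (b * r ord0 z.1)))%:E * (expR (- (b * coordinate_sum r' z.2)))%:E.
  rewrite -EFinM -expRD /coordinate_sum big_ord_recl mulrDr opprD; congr (expR (_ + - (b * _)))%:E.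
  by apply: eq_bigr => i _; rewrite tnthS.
rewrite (eq_integral (fun z => (expR (- (b * r ord0 z.1)))%:E *
    (expR (- (b * coordinate_sum r' z.2)))%:E)); last by move=> z _; exact: totalE.
have mprod : measurable_fun setT (fun z : T * n.-tuple T =>
    (expR (- (b * r ord0 z.1)))%:E * (expR (- (b * coordinate_sum r' z.2)))%:E).
  apply: emeasurable_funM; apply/measurable_EFinP.
    exact: measurableT_comp mexp0 measurable_fst.
  exact: measurableT_comp mexp' measurable_snd.
rewrite fubini_tonelli1//=.
rewrite /fubini_F/=.
under eq_integral => x _.
  rewrite ge0_integralZl_EFin ?expR_ge0//; last exact/measurable_EFinP.
  rewrite (IH r' (fun i => mr _) (fun i => r0 _)).
  rewrite muleC; over.
rewrite ge0_integralZl_EFin ?expR_ge0//; last exact/measurable_EFinP.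
rewrite laplaceE// laplaceK// -EFinM -expRD big_ord_recl opprD addrC.
by [].
Qed.

(** Independence, in the form in which it is used: free energies add up. *)
Lemma free_energy_power n (r : 'I_n -> T -> R) (b : R) : (0 <= b)%R ->
  (forall i, measurable_fun setT (r i)) -> (forall i y, (0 <= r i y)%R) ->
  free_energy (power_measure Q n) (coordinate_sum r) b =
  (\sum_(i < n) free_energy Q (r i) b)%R.
Proof.
move=> b0 mr r0.
rewrite /free_energy /laplace /Rintegral laplace_power//= expRK opprK.
by apply: eq_bigr.
Qed.

End power_free_energy.

(** * Relative entropy *)

(** The logarithm of a density may have integral +oo; the positive and the
    negative parts are therefore compared separately. *)
Lemma ae_le_integral d (T : measurableType d) (R : realType)
    (mu : {measure set T -> \bar R}) (f g : T -> \bar R) :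
  measurable_fun setT f -> measurable_fun setT g ->
  {ae mu, forall x, f x <= g x} -> \int[mu]_x f x <= \int[mu]_x g x.
Proof.
move=> mf mg fg; rewrite integralE [leRHS]integralE; apply: leeB.
- apply: ae_ge0_le_integral => //; try exact: measurable_funepos.
  by apply: filterS fg => x fgx _; rewrite !funeposE ge_max !le_max fgx lexx orbT.
- apply: ae_ge0_le_integral => //; try exact: measurable_funeneg.
  by apply: filterS fg => x fgx _; rewrite !funenegE ge_max !le_max leeN2 fgx lexx orbT.
Qed.

Section entropy.
Context d (T : measurableType d) (R : realType).
Implicit Types (W V : probability T R) (g : T -> R).

Lemma measurable_lne_fin (f : T -> \bar R) : measurable_fun setT f ->
  (forall x, f x \is a fin_num) -> measurable_fun setT (fun x => lne (f x)).
Proof.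
move=> mf ffin.
rewrite (_ : (fun x => _) = (fun x => if (fine (f x) <= 0)%R then -oo
   else (ln (fine (f x)))%:E)); last first.
  by apply/funext => x; rewrite -(fineK (ffin x)).
have mfine : measurable_fun setT (fun x => fine (f x)) by exact: measurableT_comp.
apply: measurable_fun_ifT => //; first exact: measurable_fun_ler.
exact/measurable_EFinP/measurableT_comp.
Qed.

(** With f = dW/dV, the inequality 1 + u <= exp u at u = g - ln f reads
    ln f >= g + 1 - exp(g)/f.  The W-integral of exp(g)/f is the V-integral of
    exp g over the set where f > 0, hence at most 1. *)
Lemma gibbs_variational W V g : W.-integrable setT (EFin \o g) ->
  \int[V]_z (expR (g z))%:E <= 1 ->
  \int[W]_z (g z)%:E <= relative_entropy W V.
Proof.
move=> ig expg; rewrite /relative_entropy; case: asboolP => [WV|_]; last exact: leey.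
have mg : measurable_fun setT g by exact/measurable_EFinP/(measurable_int _ ig).
set phi := Radon_Nikodym _ _.
pose f := Radon_Nikodym_SigmaFinite.f W V.
have f_ge0 z : 0 <= f z := Radon_Nikodym_SigmaFinite.f_ge0 WV z.
have f_fin z : f z \is a fin_num := Radon_Nikodym_SigmaFinite.f_fin_num WV z.
have mf : measurable_fun setT f.
  exact: measurable_int (Radon_Nikodym_SigmaFinite.f_integrable WV).
have mff : measurable_fun setT (fun z => fine (f z)) by exact: measurableT_comp.
have mphi : measurable_fun setT phi.
  exact: measurable_int (Radon_Nikodym_integrable (nu := charge_of_finite_measure W) WV).
have fphi : ae_eq W setT f phi.
  apply: (null_dominates_ae_eq _ WV) => //.
  exact: ae_eq_Radon_Nikodym_SigmaFinite.
(* F is exp(g)/f where f > 0. *)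
pose F z : R := (if (fine (f z) <= 0)%R then 0 else expR (g z - ln (fine (f z))))%R.
have mF : measurable_fun setT F.
  apply: measurable_fun_ifT => //; first exact: measurable_fun_ler.
  by apply: measurableT_comp => //; apply: measurable_funB => //; exact: measurableT_comp.
have F_ge0 z : (0 <= F z)%R by rewrite /F; case: ifPn => // _; exact: expR_ge0.
have intF : \int[W]_z (F z)%:E <= 1.
  rewrite -(Radon_Nikodym_SigmaFinite.change_of_variables WV)//; last first.
    exact/measurable_EFinP.
  apply: le_trans expg; apply: ge0_le_integral => //.
  - by move=> z _; rewrite mule_ge0// lee_fin.
  - by apply: emeasurable_funM => //; exact/measurable_EFinP.
  - exact/measurable_EFinP/measurableT_comp.
  - move=> z _; rewrite -/f -(fineK (f_fin z)) -EFinM lee_fin /F.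
    case: (lerP (fine (f z)) 0) => [_|f0]; first by rewrite mul0r expR_ge0.
    by rewrite expRB lnK ?posrE// divfK// gt_eqF.
have iF : W.-integrable setT (EFin \o F).
  apply/integrableP; split; first exact/measurable_EFinP.
  under eq_integral do rewrite gee0_abs ?lee_fin//.
  exact: le_lt_trans intF (ltry _).
have i1 : W.-integrable setT (EFin \o cst 1%R : T -> \bar R).
  exact: finite_measure_integrable_cst.
have ig1 : W.-integrable setT (fun z => (g z)%:E + 1%:E).
  by have := integrableD measurableT ig i1; apply: eq_integrable.
have Ih : \int[W]_z ((g z)%:E + 1%:E - (F z)%:E) =
    \int[W]_z (g z)%:E + 1 - \int[W]_z (F z)%:E.
  rewrite (integralB measurableT ig1 iF) (integralD measurableT ig i1).
  congr (_ + _ - _).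
  by rewrite (integral_cst _ _ 1)//= probability_setT mule1.
apply: (@le_trans _ _ (\int[W]_z ((g z)%:E + 1%:E - (F z)%:E))).
  rewrite Ih -(fineK (integrable_fin_num measurableT ig)).
  rewrite -(fineK (integrable_fin_num measurableT iF)) in intF *.
  by rewrite -!EFinD lee_fin; rewrite lee_fin in intF; lra.
apply: ae_le_integral.
- exact: measurable_int (integrableB measurableT ig1 iF).
- apply: measurable_lne_fin => // z.
  exact: (Radon_Nikodym_fin_num (nu := charge_of_finite_measure W) z WV).
- have mZ : measurable [set z | (fine (f z) <= 0)%R].
    rewrite -[X in measurable X]setTI.
    exact: measurable_fun_ler mff (measurable_cst _) measurableT _ _.
  have Z0 : {ae W, forall z, (0 < fine (f z))%R}.
    exists [set z | (fine (f z) <= 0)%R]; split => //.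
      rewrite (Radon_Nikodym_SigmaFinite.f_integral WV)//.
      apply: integral0_eq => z /= fz.
      by apply/eqP; rewrite -/(f z) eq_le f_ge0 andbT -(fineK (f_fin z)) lee_fin.
    by move=> z /= /negP; rewrite -leNgt.
  apply: filterS2 Z0 fphi => z fz /(_ I) <-.
  have -> : F z = expR (g z - ln (fine (f z))) by rewrite /F leNgt fz.
  rewrite -(fineK (f_fin z)) lne_EFin// -!EFinD lee_fin.
  by have := expR_ge1Dx (g z - ln (fine (f z))); lra.
Qed.

Lemma exists_density_measure V (f : T -> R) : measurable_fun setT f ->
  (forall z, (0 <= f z)%R) -> \int[V]_z (f z)%:E = 1 ->
  exists W, forall E, W E = \int[V]_(z in E) (f z)%:E.
Proof.
move=> mf f0 f1.
pose m (E : set T) := \int[V]_(z in E) (f z)%:E.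
have m0 : m set0 = 0 by exact: integral_set0.
have m_ge0 E : 0 <= m E by apply: integral_ge0 => z _; rewrite lee_fin.
have m_add : semi_sigma_additive m.
  move=> E mE tE mUE; rewrite /m ge0_integral_bigcup//; last 2 first.
  - exact/measurable_funTS/measurable_EFinP.
  - by move=> z _; rewrite lee_fin.
  by apply: is_cvg_ereal_nneg_natsum_cond => n _ _; exact: m_ge0.
pose M := isMeasure.Build d T R m m0 m_ge0 m_add.
pose mm : {measure set T -> \bar R} := HB.pack m M.
have mT : mm setT = 1 by exact: f1.
pose N := Measure_isProbability.Build d T R mm mT.
pose W : probability T R := HB.pack (mm : set T -> \bar R) mm N.
by exists W.
Qed.

Section density.
Variables (W V : probability T R) (f : T -> R).
Hypothesis mf : measurable_fun setT f.
Hypothesis Wf : forall E, measurable E -> W E = \int[V]_(z in E) (f z)%:E.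

Lemma density_dominates : W `<< V.
Proof.
apply/null_content_dominatesP => E mE VE.
by rewrite Wf//; apply: null_set_integral => //; exact/measurable_funTS/measurable_EFinP.
Qed.

Lemma density_ae_eq (phi : T -> \bar R) : V.-integrable setT phi ->
  (forall E, measurable E -> W E = \int[V]_(z in E) phi z) ->
  ae_eq V setT phi (EFin \o f).
Proof.
move=> iphi Wphi; apply: integral_ae_eq => //; first exact/measurable_EFinP.
by move=> E _ mE; rewrite -Wphi// Wf.
Qed.

Lemma ge0_integral_density (h : T -> \bar R) : measurable_fun setT h ->
  (forall z, 0 <= h z) ->
  \int[W]_z h z = \int[V]_z (h z * (f z)%:E).
Proof.
move=> mh h0; have WV := density_dominates.
rewrite -(Radon_Nikodym_SigmaFinite.change_of_variables WV)//.
have iRN := Radon_Nikodym_SigmaFinite.f_integrable WV.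
apply: ae_eq_integral => //.
- by apply: emeasurable_funM => //; exact: measurable_int iRN.
- by apply: emeasurable_funM => //; exact/measurable_EFinP.
- have := density_ae_eq iRN (fun E mE => Radon_Nikodym_SigmaFinite.f_integral WV mE).
  by apply: filterS => z /= + _ => /(_ I) ->.
Qed.

Lemma relative_entropy_density g : measurable_fun setT g ->
  (forall z, f z = expR (g z)) ->
  relative_entropy W V = \int[W]_z (g z)%:E.
Proof.
move=> mg fg; rewrite /relative_entropy; have WV := density_dominates.
case: asboolP => // _.
have iRN := Radon_Nikodym_integrable (nu := charge_of_finite_measure W) WV.
apply: ae_eq_integral => //.
- apply: measurable_lne_fin; first exact: measurable_int iRN.
  by move=> z; exact: (Radon_Nikodym_fin_num (nu := charge_of_finite_measure W) z WV).
- exact/measurable_EFinP.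
- apply: (null_dominates_ae_eq _ WV) => //.
  have := density_ae_eq iRN (fun E mE =>
    Radon_Nikodym_integral (nu := charge_of_finite_measure W) WV mE).
  apply: filterS => z /= + _ => /(_ I) ->.
  by rewrite fg lne_EFin ?expR_gt0// expRK.
Qed.

End density.
End entropy.

(** * The infimum of relative entropy *)
Section rate.
Context d1 d2 (A : measurableType d1) (B : measurableType d2) (R : realType).
Variables (P : probability A R) (Q : probability B R) (rho : A * B -> R).
Hypotheses (rho_ge0 : forall z, (0 <= rho z)%R) (mrho : measurable_fun setT rho).
Hypothesis irho : (P \x Q).-integrable setT (EFin \o rho).

Local Notation section x := (fun y => rho (x, y)).

Let msection x : measurable_fun setT (section x).
Proof. exact: measurable_fun_pair2. Qed.

Let section_ge0 x y : (0 <= rho (x, y))%R. Proof. exact: rho_ge0. Qed.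

Lemma integral_first_marginal (W : probability (A * B)%type R) (h : A -> \bar R) :
  (forall E, measurable E -> W (E `*` setT) = P E) ->
  measurable_fun setT h -> (forall x, 0 <= h x) ->
  \int[W]_z h z.1 = \int[P]_x h x.
Proof.
move=> WP mh h0.
have /= <- // := ge0_integral_pushforward (@measurable_fst _ _ A B) W measurableT mh.
apply: eq_measure_integral => E mE _; apply: etrans (WP E mE).
by congr (W _); apply/seteqP; split=> z /=; [split|case].
Qed.

Variable b : R.
Hypothesis b_ge0 : (0 <= b)%R.

(** The logarithm of the density, relative to P x Q, of the joint law with
    first marginal P and conditional laws tilted by exp(-b rho). *)
Definition gibbs_log_density (z : A * B) : R :=
  (free_energy Q (section z.1) b - b * rho z)%R.

Local Notation g := gibbs_log_density.

Lemma measurable_gibbs_log_density : measurable_fun setT g.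
Proof.
apply: measurable_funB; last exact: measurable_funM.
exact: measurableT_comp (measurable_free_energy Q mrho b) measurable_fst.
Qed.

(** Given x, the density integrates to 1 in y.  This gives both the total mass
    and the first marginal. *)
Lemma integral_gibbs_density_fst (h : A -> \bar R) : measurable_fun setT h ->
  (forall x, 0 <= h x) ->
  \int[P \x Q]_z (h z.1 * (expR (g z))%:E) = \int[P]_x h x.
Proof.
move=> mh h0; have mg := measurable_gibbs_log_density.
rewrite fubini_tonelli1//; last 2 first.
- apply: emeasurable_funM; first exact: measurableT_comp mh measurable_fst.
  exact/measurable_EFinP/measurableT_comp.
- by move=> z; rewrite mule_ge0// lee_fin expR_ge0.
apply: eq_integral => x _; rewrite /fubini_F/=.
have mexp := measurable_boltzmann (msection x) b.
under eq_integral do rewrite /g/= expRD EFinM muleA.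
rewrite ge0_integralZl//; last 2 first.
- exact/measurable_EFinP.
- by rewrite mule_ge0// lee_fin expR_ge0.
by rewrite laplaceE// laplaceK// -muleA -EFinM -expRD subrr expR0 mule1.
Qed.

Lemma integral_gibbs_density : \int[P \x Q]_z (expR (g z))%:E = 1.
Proof.
have := @integral_gibbs_density_fst (cst 1) (measurable_cst _) (fun=> @lee01 R).
rewrite (integral_cst _ _ 1)//= probability_setT mule1 => <-.
by apply: eq_integral => z _; rewrite mul1e.
Qed.

Lemma integral_gibbs_distortion :
  \int[P \x Q]_z ((rho z)%:E * (expR (g z))%:E) = (mean_distortion P Q rho b)%:E.
Proof.
have mg := measurable_gibbs_log_density.
have mrg : measurable_fun setT (fun z => (rho z)%:E * (expR (g z))%:E).
  by apply: emeasurable_funM; apply/measurable_EFinP => //; exact: measurableT_comp.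
have rg_ge0 z : 0 <= (rho z)%:E * (expR (g z))%:E.
  by rewrite mule_ge0// lee_fin// expR_ge0.
have ig := integrable_gibbs_mean rho_ge0 mrho irho b_ge0.
rewrite fubini_tonelli1// fineK; last exact: integrable_fin_num.
apply: ae_eq_integral => //.
- exact: measurable_fun_fubini_tonelli_F.
- exact: measurable_int ig.
- apply: filterS (ae_integrable1 irho) => x ix _; rewrite /fubini_F/=.
  have mexp := measurable_boltzmann (msection x) b.
  under eq_integral do rewrite /g/= expRD -EFinM mulrCA EFinM.
  rewrite ge0_integralZl ?expR_ge0//; last 2 first.
  + exact/measurable_EFinP/measurable_funM.
  + by move=> y _; rewrite lee_fin mulr_ge0 ?expR_ge0.
  rewrite -(fineK (integrable_fin_num measurableT (integrable_energy (msection x)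
    (section_ge0 x) ix b_ge0))).
  rewrite -EFinM; congr _%:E.
  rewrite -/(Rintegral Q setT _) gibbs_meanK// laplaceK//.
  by rewrite mulrCA -expRD subrr expR0 mulr1.
Qed.

(** On laws W with first marginal P, the integral of the logarithmic density
    depends on W only through the mean distortion. *)
Lemma integral_gibbs_log_density (W : probability (A * B)%type R) :
  (forall E, measurable E -> W (E `*` setT) = P E) ->
  \int[W]_z (rho z)%:E < +oo ->
  W.-integrable setT (EFin \o g) /\
  \int[W]_z (g z)%:E =
    (mean_free_energy P Q rho b)%:E - b%:E * \int[W]_z (rho z)%:E.
Proof.
move=> WP rhoW.
have mU := measurable_free_energy Q mrho b.
have iU := integrable_free_energy rho_ge0 mrho irho b_ge0.
have IU : \int[W]_z (free_energy Q (section z.1) b)%:E =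
    (mean_free_energy P Q rho b)%:E.
  rewrite (@integral_first_marginal W (fun x => (free_energy Q (section x) b)%:E))//.
  - by rewrite fineK// integrable_fin_num.
  - exact/measurable_EFinP.
  - by move=> x; rewrite lee_fin free_energy_ge0.
have iU1 : W.-integrable setT (fun z => (free_energy Q (section z.1) b)%:E).
  apply/integrableP; split.
    by apply/measurable_EFinP; exact: measurableT_comp mU measurable_fst.
  under eq_integral do rewrite gee0_abs ?lee_fin ?free_energy_ge0//.
  by rewrite IU ltry.
have ir : W.-integrable setT (EFin \o rho).
  apply/integrableP; split; first exact/measurable_EFinP.
  by under eq_integral do rewrite gee0_abs ?lee_fin//.
have ibr := integrableZl measurableT b ir.
split; first by have := integrableB measurableT iU1 ibr; apply: eq_integrable.
rewrite -IU -(integralZl measurableT ir) -integralB//.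
Qed.

(** The infimum is attained at the Gibbs law: the logarithmic density is the
    extremal function in gibbs_variational, and a smaller mean distortion only
    increases its integral. *)
Theorem rate1_gibbs (D : R) : mean_distortion P Q rho b = D ->
  rate1 rho P Q D = (mean_free_energy P Q rho b - b * D)%:E.
Proof.
move=> bD; have mg := measurable_gibbs_log_density.
apply/eqP; rewrite eq_le; apply/andP; split.
- have mexpg : measurable_fun setT (fun z => expR (g z)) by exact: measurableT_comp.
  have expg_ge0 z : (0 <= expR (g z))%R by exact: expR_ge0.
  have [W WE] := exists_density_measure mexpg expg_ge0 integral_gibbs_density.
  have WE' E : measurable E -> W E = \int[P \x Q]_(z in E) (expR (g z))%:E by [].
  have WP E : measurable E -> W (E `*` setT) = P E.
    move=> mE; have <- : \int[P]_x (\1_E x)%:E = P E.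
      by rewrite integral_indic ?setIT.
    rewrite WE -integral_gibbs_density_fst; last 2 first.
    + exact/measurable_EFinP/measurable_indic.
    + by move=> x; rewrite lee_fin.
    rewrite integral_mkcond; apply: eq_integral => z _.
    rewrite patchE indicE; case: ifPn => [/set_mem[/= zE _]|/negP zE].
      by rewrite mem_set// mul1e.
    by rewrite memNset ?mul0e// => Ez; apply: zE; apply/mem_set.
  have Wrho : \int[W]_z (rho z)%:E = D%:E.
    rewrite (ge0_integral_density mexpg WE')//; last exact/measurable_EFinP.
    by rewrite integral_gibbs_distortion bD.
  apply: ereal_inf_lbound; exists W => /=; first by rewrite Wrho lexx.
  have rho_lty : \int[W]_z (rho z)%:E < +oo by rewrite Wrho ltry.
  have [_ Ig] := integral_gibbs_log_density WP rho_lty.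
  by rewrite (relative_entropy_density mexpg WE' mg)// Ig Wrho.
- apply: le_ereal_inf_tmp => _ [W /= [WP Wrho] <-].
  have [ig Ig] := integral_gibbs_log_density WP (le_lt_trans Wrho (ltry D)).
  apply: le_trans (gibbs_variational ig _); last by rewrite integral_gibbs_density.
  rewrite Ig EFinB EFinM leeB// lee_wpmul2l// lee_fin.
Qed.

End rate.

(** * Asymptotics of the probability of a distortion ball *)

(** Both error terms on the right-hand side are exponentially small relative to
    exp(-n u2): they are eventually at most a quarter of it, so the first term
    is at least half of it. *)
Lemma eventually_ln_ge (R : realType) (p u1 u2 u3 : nat -> R)
    (b1 b2 b3 D0 D G1 G2 G3 e : R) :
  u1 n @[n --> \oo] --> G1 -> u2 n @[n --> \oo] --> G2 -> u3 n @[n --> \oo] --> G3 ->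
  (0 < G3 - G2 + (b2 - b3) * D)%R -> (0 < G1 - G2 - (b1 - b2) * D0)%R ->
  (forall n, (0 < n)%N ->
    expR (- (n%:R * u2 n)) <= expR (- (n%:R * (b2 * D0))) * p n +
      expR (- (n%:R * (u3 n + (b2 - b3) * D))) +
      expR (- (n%:R * (u1 n - (b1 - b2) * D0))))%R ->
  (0 < e)%R ->
  \forall n \near \oo, (0 < p n)%R /\
    (- (n%:R^-1 * ln (p n)) <= G2 - b2 * D0 + e)%R.
Proof.
move=> cu1 cu2 cu3 a0 c0 ineq e0.
pose eta := (Num.min (G3 - G2 + (b2 - b3) * D) (G1 - G2 - (b1 - b2) * D0) / 2)%R.
have eta0 : (0 < eta)%R by rewrite divr_gt0// lt_min a0 c0.
have eta_a : (eta < G3 - G2 + (b2 - b3) * D)%R.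
  by rewrite /eta; case: (lerP (G3 - G2 + (b2 - b3) * D) (G1 - G2 - (b1 - b2) * D0)); lra.
have eta_c : (eta < G1 - G2 - (b1 - b2) * D0)%R.
  by rewrite /eta; case: (lerP (G3 - G2 + (b2 - b3) * D) (G1 - G2 - (b1 - b2) * D0)); lra.
have ca : (u3 n - u2 n + (b2 - b3) * D)%R @[n --> \oo] --> (G3 - G2 + (b2 - b3) * D)%R.
  by apply: cvgD; [exact: cvgB|exact: cvg_cst].
have cc : (u1 n - u2 n - (b1 - b2) * D0)%R @[n --> \oo] --> (G1 - G2 - (b1 - b2) * D0)%R.
  by apply: cvgB; [exact: cvgB|exact: cvg_cst].
have e2 : (0 < e / 2)%R by rewrite divr_gt0.
have u2_lt : (G2 < G2 + e / 2)%R by rewrite ltrDl.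
near=> n.
have n0 : (0 < n)%N by near: n; exact: nbhs_infty_gt.
have n0' : (0 < n%:R :> R)%R by rewrite ltr0n.
have an : (eta <= u3 n - u2 n + (b2 - b3) * D)%R by near: n; exact: cvgr_ge ca _ eta_a.
have cn : (eta <= u1 n - u2 n - (b1 - b2) * D0)%R by near: n; exact: cvgr_ge cc _ eta_c.
have u2n : (u2 n <= G2 + e / 2)%R by near: n; exact: cvgr_le cu2 _ u2_lt.
have n3 : (3 <= n%:R * eta)%R.
  by rewrite -ler_pdivrMr//; near: n; exact: nbhs_infty_ger.
have nln : (ln 2 <= n%:R * (e / 2))%R.
  by rewrite -ler_pdivrMr//; near: n; exact: nbhs_infty_ger.
(* n * eta >= 3 makes exp (n * eta) >= 1 + n * eta >= 4. *)
have quarter v : (n%:R * eta <= v)%R -> (expR (- v) <= 1 / 4)%R.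
  move=> ev; rewrite expRN ler_pdivlMr// mulrC ler_pdivrMr ?expR_gt0// mul1r.
  by have := expR_ge1Dx v; lra.
pose c := expR (- (n%:R * u2 n)).
have c0' : (0 < c)%R := expR_gt0 _.
have := ineq n n0.
rewrite -/c.
have -> : expR (- (n%:R * (u3 n + (b2 - b3) * D))) =
    (c * expR (- (n%:R * (u3 n - u2 n + (b2 - b3) * D))))%R.
  by rewrite -expRD; congr expR; ring.
have -> : expR (- (n%:R * (u1 n - (b1 - b2) * D0))) =
    (c * expR (- (n%:R * (u1 n - u2 n - (b1 - b2) * D0))))%R.
  by rewrite -expRD; congr expR; ring.
have q1 := quarter _ (ler_wpM2l (ltW n0') an).
have q2 := quarter _ (ler_wpM2l (ltW n0') cn).
have {}q1 := ler_wpM2l (ltW c0') q1; have {}q2 := ler_wpM2l (ltW c0') q2.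
move=> main.
have half : (c / 2 <= expR (- (n%:R * (b2 * D0))) * p n)%R by lra.
have pn : (expR (n%:R * (b2 * D0) - n%:R * u2 n) / 2 <= p n)%R.
  have -> : (expR (n%:R * (b2 * D0) - n%:R * u2 n) / 2 =
      expR (n%:R * (b2 * D0)) * (c / 2))%R by rewrite expRD -mulrA.
  have -> : p n = (expR (n%:R * (b2 * D0)) * (expR (- (n%:R * (b2 * D0))) * p n))%R.
    by rewrite mulrA -expRD subrr expR0 mul1r.
  by rewrite ler_pM2l ?expR_gt0.
have p0 : (0 < p n)%R by apply: lt_le_trans pn; rewrite divr_gt0 ?expR_gt0.
split => //.
have lnp : (n%:R * (b2 * D0) - n%:R * u2 n - ln 2 <= ln (p n))%R.
  by rewrite -[X in (X - _)%R]expRK -ln_div ?posrE ?expR_gt0// ler_ln ?posrE// divr_gt0 ?expR_gt0.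
rewrite lerNl -(ler_pM2l n0') mulVKf ?gt_eqF//; apply: le_trans lnp.
rewrite -subr_ge0; have := ler_wpM2l (ltW n0') u2n; lra.
Unshelve. all: by end_near. Qed.

Lemma scale_exponents (R : realType) (n u1 u2 u3 b1 b2 b3 D0 D p : R) :
  (expR (- (n * u2)) <= expR (- (b2 * (n * D0))) * p +
     expR (- (n * u3) - (b2 - b3) * (n * D)) +
     expR (- (n * u1) + (b1 - b2) * (n * D0)))%R ->
  (expR (- (n * u2)) <= expR (- (n * (b2 * D0))) * p +
     expR (- (n * (u3 + (b2 - b3) * D))) +
     expR (- (n * (u1 - (b1 - b2) * D0))))%R.
Proof.
have -> : (b2 * (n * D0) = n * (b2 * D0))%R by ring.
have -> : (- (n * u3) - (b2 - b3) * (n * D) = - (n * (u3 + (b2 - b3) * D)))%R by ring.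
by have -> : (- (n * u1) + (b1 - b2) * (n * D0) = - (n * (u1 - (b1 - b2) * D0)))%R
  by ring.
Qed.

Section ball_probability.
Context d1 d2 (A : measurableType d1) (B : measurableType d2) (R : realType).
Variables (Q : probability B R) (rho : A * B -> R).
Hypotheses (rho_ge0 : forall z, (0 <= rho z)%R) (mrho : measurable_fun setT rho).
Variable x : nat -> A.
Variable D : R.

Local Notation section a := (fun y => rho (a, y)).

Definition empirical_free_energy b n : R :=
  (n%:R^-1 * \sum_(i < n) free_energy Q (section (x i)) b)%R.

Definition ball_probability n : R :=
  fine (power_measure Q n (distortion_ball rho [tuple x i | i < n] D)).

Let r n (i : 'I_n) := section (x i).

Let mr n (i : 'I_n) : measurable_fun setT (r i).
Proof. exact: measurable_fun_pair2. Qed.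

Let r_ge0 n (i : 'I_n) y : (0 <= r i y)%R. Proof. exact: rho_ge0. Qed.

Lemma distortion_ballE n : (0 < n)%N ->
  distortion_ball rho [tuple x i | i < n] D =
  [set y | coordinate_sum (@r n) y <= n%:R * D]%R.
Proof.
move=> n0; rewrite /distortion_ball /distortion; apply/seteqP.
have E (y : n.-tuple B) : (\sum_(i < n) rho (tnth [tuple x i | i < n] i, tnth y i) =
    coordinate_sum (@r n) y)%R by apply: eq_bigr => i _; rewrite tnth_mktuple.
by split=> y /=; rewrite E ler_pdivrMl// ltr0n.
Qed.

Lemma coordinate_sum_free_energyE n b : (0 < n)%N -> (0 <= b)%R ->
  free_energy (power_measure Q n) (coordinate_sum (@r n)) b =
  (n%:R * empirical_free_energy b n)%R.
Proof.
move=> n0 b0; rewrite free_energy_power// /empirical_free_energy mulVKf//.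
by rewrite gt_eqF// ltr0n.
Qed.

Let mtotal n : measurable_fun setT (coordinate_sum (@r n)).
Proof. exact: measurable_coordinate_sum. Qed.

Let total_ge0 n y : (0 <= coordinate_sum (@r n) y)%R.
Proof. by apply: sumr_ge0 => i _; exact: r_ge0. Qed.

Lemma ball_probabilityE n : (0 < n)%N -> (ball_probability n)%:E =
  power_measure Q n (distortion_ball rho [tuple x i | i < n] D).
Proof.
move=> n0; rewrite fineK// fin_num_measure// distortion_ballE//.
rewrite -[X in measurable X]setTI (_ : [set y | _] = coordinate_sum (@r n) @^-1` `]-oo, (n%:R * D)%R]).
  exact: mtotal.
by apply/seteqP; split=> y /=; rewrite in_itv.
Qed.

Lemma ball_probability_upper n b : (0 < n)%N -> (0 <= b)%R ->
  (ball_probability n <= expR (n%:R * (b * D - empirical_free_energy b n)))%R.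
Proof.
move=> n0 b0.
have := chernoff_upper (power_measure Q n) (@mtotal n) (@total_ge0 n) (n%:R * D) b0.
rewrite -distortion_ballE// coordinate_sum_free_energyE//.
rewrite -lee_fin ball_probabilityE//.
suff -> : (b * (n%:R * D) - n%:R * empirical_free_energy b n =
    n%:R * (b * D - empirical_free_energy b n))%R by [].
by ring.
Qed.

Lemma ball_probability_lower n b1 b2 b3 D0 : (0 < n)%N ->
  (0 <= b3)%R -> (b3 <= b2)%R -> (b2 <= b1)%R ->
  (expR (- (n%:R * empirical_free_energy b2 n)) <=
   expR (- (n%:R * (b2 * D0))) * ball_probability n +
   expR (- (n%:R * (empirical_free_energy b3 n + (b2 - b3) * D))) +
   expR (- (n%:R * (empirical_free_energy b1 n - (b1 - b2) * D0))))%R.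
Proof.
move=> n0 b3_ge0 b32 b21.
have b2_ge0 := le_trans b3_ge0 b32; have b1_ge0 := le_trans b2_ge0 b21.
have := @tilting_lower _ _ _ (power_measure Q n) _ (@mtotal n) (@total_ge0 n)
  b1 b2 b3 (n%:R * D0) (n%:R * D) b3_ge0 b32 b21.
rewrite -distortion_ballE// !coordinate_sum_free_energyE// -/(ball_probability n).
exact: scale_exponents.
Qed.

End ball_probability.

(** The arithmetic behind the choice of temperatures: mean distortions
    D - 3 dl, D - 2 dl and D - dl at b1 > b2 > b3, and the level D0 = D - 4 dl.
    The three inequalities on G2 are tangents at b3, b1 and bs. *)
Lemma temperatures_arith (R : realType) (G1 G2 G3 Gs b1 b2 b3 bs bl D dl e : R) :
  (0 < dl)%R -> (b3 < b2)%R -> (b2 < b1)%R -> (b2 <= bl)%R -> (bl * (4 * dl) <= e)%R ->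
  (G2 <= G3 + (b2 - b3) * (D - dl))%R ->
  (G2 <= G1 + (b2 - b1) * (D - 3 * dl))%R ->
  (G2 <= Gs + (b2 - bs) * D)%R ->
  [/\ (0 < G3 - G2 + (b2 - b3) * D)%R,
      (0 < G1 - G2 - (b1 - b2) * (D - 4 * dl))%R &
      (G2 - b2 * (D - 4 * dl) <= Gs - bs * D + e)%R].
Proof.
move=> dl0 b32 b21 b2l ble h3 h1 hs.
have p1 : (0 < (b2 - b3) * dl)%R by rewrite mulr_gt0// subr_gt0.
have p2 : (0 < (b1 - b2) * dl)%R by rewrite mulr_gt0// subr_gt0.
have p3 : (0 <= (bl - b2) * dl)%R by rewrite mulr_ge0 ?subr_ge0 // ltW.
by split; lra.
Qed.

Section temperatures.
Context d1 d2 (A : measurableType d1) (B : measurableType d2) (R : realType).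
Variables (P : probability A R) (Q : probability B R) (rho : A * B -> R).
Hypotheses (rho_ge0 : forall z, (0 <= rho z)%R) (mrho : measurable_fun setT rho).
Hypothesis irho : (P \x Q).-integrable setT (EFin \o rho).

Local Notation G := (mean_free_energy P Q rho).
Local Notation M := (mean_distortion P Q rho).

(** The three temperatures required by tilting_lower.  They all lie below bl, so
    replacing D by D0 costs at most bl (D - D0) in the exponent. *)
Lemma exists_temperatures (D bl bs e : R) : (0 < bl)%R -> (M bl < D)%R ->
  D%:E < Dav rho P Q -> (0 <= bs)%R -> M bs = D -> (0 < e)%R ->
  exists b1 b2 b3 D0, [/\ (0 <= b3)%R, (b3 <= b2)%R & (b2 <= b1)%R] /\
    [/\ (0 < G b3 - G b2 + (b2 - b3) * D)%R,
        (0 < G b1 - G b2 - (b1 - b2) * D0)%R &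
        (G b2 - b2 * D0 <= G bs - bs * D + e)%R].
Proof.
move=> bl0 Ml DDav bs0 Ms e0.
(* D - 4 dl must stay above M bl, and bl * (4 dl) below e. *)
pose dl := (Num.min (D - M bl) (e / bl) / 5)%R.
have m0 : (0 < Num.min (D - M bl) (e / bl))%R by rewrite lt_min subr_gt0 Ml divr_gt0.
have dl0 : (0 < dl)%R by rewrite divr_gt0.
have dl5 : (5 * dl = Num.min (D - M bl) (e / bl))%R by rewrite /dl mulrC divfK.
have dlM : (5 * dl <= D - M bl)%R by rewrite dl5 ge_min lexx.
have dle : (bl * (5 * dl) <= e)%R.
  by rewrite mulrC -ler_pdivlMr// dl5 ge_min lexx orbT.
move: dl dl0 dlM dle {dl5 m0} => dl dl0 dlM dle.
have lt_Dav c : (0 < c)%R -> (D - c)%:E < Dav rho P Q.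
  by move=> c0; apply: lt_trans DDav; rewrite lte_fin ltrBlDr ltrDl.
have surj := mean_distortion_surj rho_ge0 mrho irho.
have Ml1 : (M bl < D - 3 * dl)%R by rewrite ltrBrDl -ltrBrDr (lt_le_trans _ dlM)// ltr_pM2r// ltr_nat.
have [b1 [b1_gt0 b1l M1]] := surj _ _ (ltW bl0) Ml1 (lt_Dav _ (mulr_gt0 (ltr0n R 3) dl0)).
have M12 : (M b1 < D - 2 * dl)%R by rewrite M1 ltrD2l ltrN2 ltr_pM2r// ltr_nat.
have [b2 [b2_gt0 b21 M2]] := surj _ _ (ltW b1_gt0) M12 (lt_Dav _ (mulr_gt0 (ltr0n R 2) dl0)).
have M23 : (M b2 < D - dl)%R by rewrite M2 ltrD2l ltrN2 -[ltLHS]mul1r ltr_pM2r// ltr1n.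
have [b3 [b3_gt0 b32 M3]] := surj _ _ (ltW b2_gt0) M23 (lt_Dav _ dl0).
exists b1, b2, b3, (D - 4 * dl)%R; split; first by rewrite !ltW.
have tangent := mean_free_energy_tangent rho_ge0 mrho irho.
have h3 := tangent _ _ (ltW b3_gt0) (ltW b2_gt0); rewrite M3 in h3.
have h1 := tangent _ _ (ltW b1_gt0) (ltW b2_gt0); rewrite M1 in h1.
have hs := tangent _ _ bs0 (ltW b2_gt0); rewrite Ms in hs.
have ble : (bl * (4 * dl) <= e)%R.
  by apply: le_trans dle; rewrite ler_pM2l// ler_pM2r// ler_nat.
exact: temperatures_arith dl0 b32 b21 (ltW (lt_trans b21 b1l)) ble h3 h1 hs.
Qed.

End temperatures.

Theorem theorem1 (R : realType) (A B : completeMetricType R)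
    (sepA : separable A) (sepB : separable B)
    (d : measure_display) (Omega : measurableType d) (Pr : probability Omega R)
    (X : int -> {RV Pr >-> borelType A})
    (statX : stationary X) (ergX : ergodic X)
    (P : probability (borelType A) R)
    (PE : forall E : set (borelType A), measurable E ->
       P E = distribution Pr (X 1%Z) E)
    (Q : probability (borelType B) R)
    (rho : borelType A * borelType B -> R)
    (rho_ge0 : forall z, (0 <= rho z)%R)
    (mrho : measurable_fun setT rho)
    (Dmin_lt_Dav : Dmin rho P Q < Dav rho P Q)
    (Dav_fin : Dav rho P Q \is a fin_num)
    (D : R) (DminD : Dmin rho P Q < D%:E) (DDav : D%:E < Dav rho P Q) :
  {ae Pr, forall w,
    (fun n : nat => - ((n%:R^-1)%:E *
       lne (power_measure Q n (distortion_ball rho (block X n w) D))))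
      @ \oo --> rate1 rho P Q D}.
Proof.
have irho : (P \x Q).-integrable setT (EFin \o rho).
  apply/integrableP; split; first exact/measurable_EFinP.
  under eq_integral do rewrite gee0_abs ?lee_fin//.
  by rewrite -ge0_fin_numE// integral_ge0// => z _; rewrite lee_fin.
have [bl bl0 Ml] := mean_distortion_lt rho_ge0 mrho irho DminD.
have [bs [bs0 _ Ms]] := mean_distortion_surj rho_ge0 mrho irho (ltW bl0) Ml DDav.
rewrite (rate1_gibbs rho_ge0 mrho irho (ltW bs0) Ms).
set f := (mean_free_energy P Q rho bs - bs * D)%R.
pose x w i := X i.+1%:Z w.
have avg b : (0 <= b)%R -> {ae Pr, forall w,
    empirical_free_energy Q rho (x w) b n @[n --> \oo] --> mean_free_energy P Q rho b}.
  move=> b0; apply: (ergodic_averages statX ergX PE).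
  exact: integrable_free_energy.
have upper e : (0 < e)%R -> {ae Pr, forall w, \forall n \near \oo,
    (0 < ball_probability Q rho (x w) D n)%R /\
    (- (n%:R^-1 * ln (ball_probability Q rho (x w) D n)) <= f + e)%R}.
  move=> e0; have e2 : (0 < e / 2)%R by rewrite divr_gt0.
  have [b1 [b2 [b3 [D0 [[b3_ge0 b32 b21] [ha hc hf]]]]]] :=
    exists_temperatures rho_ge0 mrho irho bl0 Ml DDav (ltW bs0) Ms e2.
  have b2_ge0 := le_trans b3_ge0 b32; have b1_ge0 := le_trans b2_ge0 b21.
  apply: filterS3 (avg _ b1_ge0) (avg _ b2_ge0) (avg _ b3_ge0) => w c1 c2 c3.
  have := eventually_ln_ge c1 c2 c3 ha hc
    (fun n n0 => ball_probability_lower Q rho_ge0 mrho (x w) D D0 n0 b3_ge0 b32 b21) e2.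
  apply: filterS => n [p0 pf]; split => //.
  by rewrite (le_trans pf)// [in leRHS](splitr e) addrA lerD2r.
(* The exceptional null set must not depend on e. *)
have all_upper : {ae Pr, forall w k, \forall n \near \oo,
    (0 < ball_probability Q rho (x w) D n)%R /\
    (- (n%:R^-1 * ln (ball_probability Q rho (x w) D n)) <= f + k.+1%:R^-1)%R}.
  by apply: ae_foralln => k; apply: upper; rewrite invr_gt0.
apply: filterS2 all_upper (avg _ (ltW bs0)) => w up cs.
pose v n : R := (- (n%:R^-1 * ln (ball_probability Q rho (x w) D n)))%R.
suff vf : v n @[n --> \oo] --> f.
  have : (EFin \o v) @ \oo --> f%:E by apply: cvg_EFin; [exact: nearW|exact: vf].
  apply: cvg_trans; apply: near_eq_cvg.
  near=> n; have n0 : (0 < n)%N by near: n; exact: nbhs_infty_gt.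
  have [p0 _] : (0 < ball_probability Q rho (x w) D n)%R /\
      (- (n%:R^-1 * ln (ball_probability Q rho (x w) D n)) <= f + 1%:R^-1)%R.
    by near: n; exact: up 0%N.
  rewrite /= /v EFinN EFinM -lne_EFin// (ball_probabilityE _ mrho)//.
suff close (e : R) : (0 < e)%R -> \forall n \near \oo, (`|f - v n| <= e)%R.
  exact/cvgrPdist_le.
move=> e0.
have [k _ /(_ k (leqnn _)) /= ke] := @near_infty_natSinv_lt R (PosNum e0).
have cf : (empirical_free_energy Q rho (x w) bs n - bs * D)%R @[n --> \oo] --> f.
  by apply: cvgB => //; exact: cvg_cst.
have fe : (f - e < f)%R by rewrite ltrBlDr ltrDl.
near=> n.
have n0 : (0 < n)%N by near: n; exact: nbhs_infty_gt.
have n0' : (0 < n%:R :> R)%R by rewrite ltr0n.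
have [p0 pe] : (0 < ball_probability Q rho (x w) D n)%R /\
    (v n <= f + k.+1%:R^-1)%R by near: n; exact: up k.
have lo : (f - e <= empirical_free_energy Q rho (x w) bs n - bs * D)%R.
  by near: n; exact: cvgr_ge cf _ fe.
have vlo : (empirical_free_energy Q rho (x w) bs n - bs * D <= v n)%R.
  rewrite lerNr -(ler_pM2l n0') mulVKf ?gt_eqF// opprB.
  rewrite -[leRHS]expRK ler_ln ?posrE ?expR_gt0//.
  exact: ball_probability_upper (ltW bs0).
rewrite ler_norml; apply/andP; split.
  by rewrite lerBrDl -lerBrDr opprK (le_trans pe)// lerD2l ltW.
by rewrite lerBlDl -lerBlDr (le_trans lo).
Unshelve. all: by end_near. Qed.
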